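(* Let $\alpha>0$ and let $\Pi$ be the Lévy measure on $\overline{K}\setminus\{0\}$ of the process $X(t)$ described in the context. For any $n=1,2,\ldots$ $$ \Pi (S\setminus S_n)=(1-q_n^{-1})\,q_n^{-ne_n}\,\frac{q_n^{(ne_n+1)(\alpha /m_n+1)}-q_n^{\alpha /m_n+1}}{q_n^{\alpha /m_n+1}-1}. $$ As $n\to \infty$, $$ \Pi (S\setminus S_n)\sim q_1^{\alpha n}, $$ that is, $\Pi(S\setminus S_n)/q_1^{\alpha n}\to 1$.
   Context: Fields. Let $k$ be a non-Archimedean local field of characteristic zero and let $k=K_1\subset K_2\subset\cdots\subset K_n\subset\cdots$ be a strictly increasing sequence of finite extensions, $K=\bigcup_{n\ge1}K_n$. For each $n$: $|\cdot|_n$ is the normalized absolute value of $K_n$; $q_n$ is the residue field cardinality of $K_n$; $m_n=[K_n:k]$; $e_n$ and $f_n$ are the ramification index and inertia index of $K_n/k$ (so $m_n=e_nf_n$, $q_n=q_1^{f_n}$); $d_n$ is the exponent of the different of $K_n/k$, i.e. the largest integer $d$ such that $|\mathrm{Tr}_{K_n/k}(x)|_1\le1$ for all $x\in K_n$ with $|x|_n\le q_n^{d}$. $\|\cdot\|$ is the absolute value on $K$ extending $|\cdot|_1$, i.e. $\|x\|=|x|_n^{1/m_n}$ for $x\in K_n$. The maps $T_n$ and the space $\overline{K}$. $T_n:K\to K_n$ is defined by $T_n(x)=\frac{m_n}{m_\nu}\mathrm{Tr}_{K_\nu/K_n}(x)$ for $x\in K_\nu$, $\nu>n$, and $T_n(x)=x$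 for $x\in K_n$; it is well defined; $T=T_1$. $\overline{K}$ is the projective limit of $\{K_n\}$ with respect to $\{T_n\}$: the set of $x=(x_1,x_2,\ldots)\in\prod_n K_n$ with $x_n=T_n(x_\nu)$ for $\nu>n$, with the topology given by the seminorms $\|x\|_n=\|x_n\|$. For $x\in\overline{K}$ put $T_n(x)=x_n$. The pairing between $K$ and $\overline{K}$ is $\langle x,y\rangle=T(xy_n)$ for $x\in K_n\subset K$, $y=(y_1,y_2,\ldots)\in\overline{K}$ (independent of the choice of $n$ with $x\in K_n$). Subgroups. $S=\{x\in\overline{K}:\ \|T_n(x)\|\le q_n^{d_n/m_n}\|m_n\|,\ n=1,2,\ldots\}$, a compact subgroup of $\overline{K}$ (here $\|m_n\|$ is the absolute value of the integer $m_n$ viewed in $k$). $S_0=S$ and $S_n=\{x\in S:\ \|T_n(x)\|\le q_n^{d_n/m_n-n/f_n}\|m_n\|\}$ for $n\ge1$; these form a descending chain of open compact subgroups of $S$ which is a base of neighbourhoods of $0$ in $S$. Process and Lévy measure. Let $\chi$ be a rank zero additive character of $k$ (a continuous unitary character trivial on $\{|x|_1\le1\}$ but not on $\{|x|_1\le q_1\}$). For $\alpha>0$ there is a convolution semigroup $\pi(t,dx)$, $t>0$, of Radon probability measures on $\overline{K}$, concentrated on $S$, with $\int_{\overline{K}}\chi(\langle\xi,x\rangle)\,\pi(t,dx)=e^{-t\|\xi\|^\alpha}$ if $\xi\in K$, $\|\xi\|>1$, and $=1$ if $\xi\in K$, $\|\xi\|\le1$; $X(t)$ is the Lévy process on $\overline{K}$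 (started at $0$) it defines. Its Lévy measure $\Pi$ is the Borel measure on $\overline{K}\setminus\{0\}$, finite outside every neighbourhood of $0$, with $\mathbf E\,\chi(\langle\lambda,X(t)\rangle)=\exp\{t\int_{\overline{K}}[\chi(\langle\lambda,x\rangle)-1]\,\Pi(dx)\}$ for all $\lambda\in K$, $t>0$; thus $\int_{\overline{K}}[\chi(\langle\lambda,x\rangle)-1]\,\Pi(dx)=-\|\lambda\|^\alpha$ if $\|\lambda\|>1$ and $=0$ if $\|\lambda\|\le1$. $\Pi$ is concentrated on $S\setminus\{0\}$; $\Pi(S\setminus S_n)$ denotes the $\Pi$-measure of $S\setminus S_n$. *)

(* Defs.v *)
From HB Require Import structures.
From mathcomp Require Import all_boot all_order all_algebra.
From mathcomp Require Import all_classical all_reals all_analysis.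
From mathcomp Require Import complex.

Set Implicit Arguments.
Unset Strict Implicit.
Unset Printing Implicit Defensive.

Import Order.TTheory GRing.Theory Num.Theory.
Import numFieldNormedType.Exports.

Local Open Scope classical_set_scope.
Local Open Scope ring_scope.

(** All fields are subfields F, E, K_n of one ambient field K. *)

Section SubfieldExtensions.
Variable K : fieldType.
Implicit Types F E : divringClosed K.

(* The rows of b : 'cV_d form a basis of E over F; c *m b is the 1 x 1 matrix
   \sum_i c_i b_i. *)
Definition is_basis F E (d : nat) (b : 'cV[K]_d) : Prop :=
  b \is a mxOver E /\
  forall x, x \in E ->
    exists! c : 'rV[K]_d, c \is a mxOver F /\ c *m b = x%:M.

Definition has_degree F E (d : nat) : Prop :=
  exists b : 'cV[K]_d, is_basis F E b.

(* t is the trace of the F-linear map "multiplication by x" on E, read off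
   from its matrix A in some basis b, i.e. x * b_i = \sum_j A_ij b_j. *)
Definition is_trace F E (x t : K) : Prop :=
  exists d (b : 'cV[K]_d) (A : 'M[K]_d),
    [/\ is_basis F E b, A \is a mxOver F, x *: b = A *m b & t = \tr A].

Definition field_trace F E (x : K) : K := xget 0 [set t | is_trace F E x t].

Lemma basis_coordmx F E d (b : 'cV[K]_d) p (v : 'cV[K]_p) :
  is_basis F E b -> v \is a mxOver E ->
  exists2 A : 'M[K]_(p, d), A \is a mxOver F & v = A *m b.
Proof.
move=> [_ hb] vE.
have /choice[c hc] : forall i, exists c : 'rV[K]_d,
    c \is a mxOver F /\ c *m b = (v i 0)%:M.
  by move=> i; have [c [hc _]] := hb _ (mxOverP vE i 0); exists c.
exists (\matrix_i c i).
  by apply/mxOverP => i j; rewrite mxE; have [/mxOverP] := hc i.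
apply/colP => i; have [_ /matrixP/(_ 0 0)] := hc i.
by rewrite !mxE eqxx mulr1n => <-; apply: eq_bigr => j _; rewrite !mxE.
Qed.

Lemma basis_coordmx_inj F E d (b : 'cV[K]_d) p (A B : 'M[K]_(p, d)) :
  {subset F <= E} -> is_basis F E b ->
  A \is a mxOver F -> B \is a mxOver F -> A *m b = B *m b -> A = B.
Proof.
move=> sFE [bE hb] AF BF eAB; apply/row_matrixP => i.
have rF (M : 'M[K]_(p, d)) : M \is a mxOver F -> row i M \is a mxOver F.
  by move=> /mxOverP MF; apply/mxOverP => ? j; rewrite mxE.
pose x := (row i A *m b) 0 0.
have xE : x \in E.
  rewrite /x mxE; apply: rpred_sum => j _; apply: rpredM.
    by apply: sFE; exact: (mxOverP (rF _ AF) 0 j).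
  exact: (mxOverP bE j 0).
have [c [_ uc]] := hb x xE.
have hA : row i A *m b = x%:M by rewrite -mx11_scalar.
by rewrite -(uc (row i A)) ?(uc (row i B)); do ?split;
  rewrite ?rF //; rewrite -hA -!row_mul eAB.
Qed.

Lemma is_trace_uniq F E x t t' : {subset F <= E} ->
  is_trace F E x t -> is_trace F E x t' -> t = t'.
Proof.
move=> sFE [d [b [A [bb AF xb ->]]]] [d' [b' [A' [bb' AF' xb' ->]]]].
have [P PF eP] := basis_coordmx bb bb'.1.
have [Q QF eQ] := basis_coordmx bb' bb.1.
have PQ1 : P *m Q = 1%:M.
  apply: (basis_coordmx_inj sFE bb'); rewrite ?mxOverM ?mxOver_scalar ?rpred0 ?rpred1//.
  by rewrite -mulmxA -eQ -eP mul1mx.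
have QP1 : Q *m P = 1%:M.
  apply: (basis_coordmx_inj sFE bb); rewrite ?mxOverM ?mxOver_scalar ?rpred0 ?rpred1//.
  by rewrite -mulmxA -eP -eQ mul1mx.
have comm : A' *m P = P *m A.
  apply: (basis_coordmx_inj sFE bb); rewrite ?mxOverM //.
  by rewrite -!mulmxA -eP -xb -scalemxAr -eP xb'.
by rewrite -[A']mulmx1 -PQ1 mulmxA comm mxtrace_mulC mulmxA QP1 mul1mx.
Qed.

Lemma field_traceE F E x t : {subset F <= E} ->
  is_trace F E x t -> field_trace F E x = t.
Proof.
move=> sFE ht; apply: (is_trace_uniq sFE _ ht).
by rewrite /field_trace; case: xgetP => [y _ //|/(_ t)].
Qed.

Lemma field_traceB F E : {subset F <= E} ->
  {in E &, {morph field_trace F E : x y / x - y}}.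
Proof.
move=> sFE x y xE yE.
have [[d [b bb]]|nb] := pselect (exists d, has_degree F E d); last first.
  have tr0 z : field_trace F E z = 0.
    rewrite /field_trace xgetPN// => t [d [b [A [bb _ _ _]]]].
    by apply: nb; exists d, b.
  by rewrite !tr0 subr0.
have coord z : z \in E -> exists2 A : 'M[K]_d, A \is a mxOver F & z *: b = A *m b.
  move=> zE; apply: (basis_coordmx bb).
  by apply/mxOverP => i j; rewrite mxE rpredM// (mxOverP bb.1).
have [[A AF xA] [B BF yB]] := (coord x xE, coord y yE).
rewrite (field_traceE sFE (_ : is_trace F E x (\tr A))); last by exists d, b, A.
rewrite (field_traceE sFE (_ : is_trace F E y (\tr B))); last by exists d, b, B.
apply: (field_traceE sFE); exists d, b, (A - B); split=> //.
- by rewrite rpredB.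
- by rewrite scalerBl mulmxBl xA yB.
- by rewrite raddfB.
Qed.

End SubfieldExtensions.

Section LocalFields.
Variables (R : realType) (K : fieldType).
Implicit Types (F E : divringClosed K) (a aF aE : K -> R).

(* r lists representatives of the residue field of F, i.e. of the quotient of
   {a <= 1} by {a < 1}. *)
Definition residue_card F a (q : nat) : Prop :=
  exists r : 'I_q -> K,
    [/\ forall i, r i \in F /\ a (r i) <= 1,
        forall i j, a (r i - r j) < 1 -> i = j &
        forall x, x \in F -> a x <= 1 -> exists i, a (x - r i) < 1].

(* Normalized: the value of a uniformizer is q^-1, q the residue cardinality. *)
Record normalized_abs F a (q : nat) : Prop := {
  nabs_ge0 : {in F, forall x, 0 <= a x};
  nabs_eq0 : {in F, forall x, (a x == 0) = (x == 0)};
  nabsM : {in F &, {morph a : x y / x * y}};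
  nabsD : {in F &, forall x y, a (x + y) <= Num.max (a x) (a y)};
  nabs_residue : residue_card F a q;
  nabs_value : {in F, forall x, x != 0 -> exists z : int, a x = q%:R ^ z};
  nabs_uniformizer : exists2 x, x \in F & a x = q%:R^-1 }.

Definition abs_complete F a : Prop :=
  forall u : nat -> K, (forall n, u n \in F) ->
    (forall eps : R, 0 < eps -> exists N : nat, forall i j : nat,
       (N <= i)%N -> (N <= j)%N -> a (u i - u j) < eps) ->
    exists2 l, l \in F & (fun n => a (u n - l)) @ \oo --> 0.

(* Non-Archimedean local field of characteristic zero, with normalized
   absolute value a: complete, discretely valued, finite residue field. *)
Definition local_field0 F a (q : nat) : Prop :=
  [/\ [pchar K] =i pred0, normalized_abs F a q & abs_complete F a].

(* aF, aE are normalized and qE is the residue cardinality of E. *)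
Definition ramification_index F aF (qF : nat) aE (qE e : nat) : Prop :=
  forall x, x \in F -> aF x = qF%:R^-1 -> aE x = qE%:R ^- e.

(* u lifts a basis of the residue field of E over that of F. *)
Definition inertia_index F aF E aE (f : nat) : Prop :=
  exists u : 'I_f -> K,
    [/\ forall i, u i \in E /\ aE (u i) <= 1,
        forall x, x \in E -> aE x <= 1 ->
          exists2 c : 'I_f -> K, forall i, c i \in F /\ aF (c i) <= 1 &
            aE (x - \sum_i c i * u i) < 1 &
        forall c : 'I_f -> K, (forall i, c i \in F /\ aF (c i) <= 1) ->
          aE (\sum_i c i * u i) < 1 -> forall i, aF (c i) < 1].

Definition trace_integral F aF E aE (qE : nat) (d : int) : Prop :=
  forall x, x \in E -> aE x <= qE%:R ^ d -> aF (field_trace F E x) <= 1.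

Definition different_exponent F aF E aE (qE : nat) (d : int) : Prop :=
  trace_integral F aF E aE qE d /\
  forall d' : int, trace_integral F aF E aE qE d' -> d' <= d.

End LocalFields.

(* The tower k = K_1 < K_2 < ... with union K. The meaningful indices start at
   1; index 0 is a dummy repeating index 1 (K_0 = k), so that a point of the
   projective limit is a sequence nat -> K whose term 0 repeats its term 1.
   The values of tw_abs n off K_n are irrelevant. *)
Record local_tower (R : realType) := LocalTower {
  tw_field :> fieldType;
  tw_sub : nat -> divringClosed tw_field;
  tw_abs : nat -> tw_field -> R;
  tw_norm : tw_field -> R;
  tw_q : nat -> nat;
  tw_m : nat -> nat;
  tw_e : nat -> nat;
  tw_f : nat -> nat;
  tw_d : nat -> int;
  tw_sub0 : tw_sub 0 =i tw_sub 1;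
  tw_subS : forall n, (0 < n)%N ->
    {subset tw_sub n <= tw_sub n.+1} /\
    exists2 x, x \in tw_sub n.+1 & x \notin tw_sub n;
  tw_union : forall x, exists n, x \in tw_sub n;
  tw_local : local_field0 (tw_sub 1) (tw_abs 1) (tw_q 1);
  tw_absP : forall n, normalized_abs (tw_sub n) (tw_abs n) (tw_q n);
  tw_mP : forall n, has_degree (tw_sub 1) (tw_sub n) (tw_m n);
  tw_eP : forall n,
    ramification_index (tw_sub 1) (tw_abs 1) (tw_q 1) (tw_abs n) (tw_q n) (tw_e n);
  tw_fP : forall n,
    inertia_index (tw_sub 1) (tw_abs 1) (tw_sub n) (tw_abs n) (tw_f n);
  tw_dP : forall n,
    different_exponent (tw_sub 1) (tw_abs 1) (tw_sub n) (tw_abs n) (tw_q n) (tw_d n);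
  tw_normP : forall n x, x \in tw_sub n ->
    tw_norm x = tw_abs n x `^ (tw_m n)%:R^-1 }.

Section ProjectiveLimit.
Variables (R : realType) (tw : local_tower R).
Local Notation K := (tw_field tw).
Local Notation Kn := (tw_sub tw).
Local Notation m := (tw_m tw).
Local Notation q := (tw_q tw).
Local Notation nrm := (@tw_norm R tw).

Lemma tw_sub_le n nu : (n <= nu)%N -> {subset Kn n <= Kn nu}.
Proof.
have step i : {subset Kn i <= Kn i.+1}.
  by case: i => [x|i]; [rewrite tw_sub0 | apply: (tw_subS _ _).1].
elim: nu => [|nu IH]; first by rewrite leqn0 => /eqP->.
by rewrite leq_eqVlt => /orP[/eqP->//|/IH h x /h /step].
Qed.

(* The restriction to K_nu of T_n : K -> K_n; x is meant to lie in K_nu. *)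
Definition tw_T (n nu : nat) (x : K) : K :=
  if (n < nu)%N then (m n)%:R / (m nu)%:R * field_trace (Kn n) (Kn nu) x
  else x.

Definition Kbar_set : set (nat -> K) :=
  [set x | (forall n, x n \in Kn n) /\
           forall n nu, (n < nu)%N -> x n = tw_T n nu (x nu)].

Definition Kbar_pred : {pred nat -> K} := [pred x | `[< Kbar_set x >]].

Lemma tw_TB n nu : {in Kn nu &, {morph tw_T n nu : x y / x - y}}.
Proof.
move=> x y xK yK; rewrite /tw_T; case: ltnP => // /ltnW le.
by rewrite -mulrBr; congr (_ * _); apply: field_traceB => //; exact: tw_sub_le.
Qed.

Lemma Kbar_zmod_closed : zmod_closed Kbar_pred.
Proof.
have TB0 n nu : tw_T n nu 0 = 0.
  by have := @tw_TB n nu 0 0 (rpred0 _) (rpred0 _); rewrite !subrr.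
split=> [|x y /asboolP[xK xT] /asboolP[yK yT]]; apply/asboolP; split.
- by move=> n; exact: rpred0.
- by move=> n nu _; rewrite [RHS]TB0.
- by move=> n; apply: rpredB; [exact: xK|exact: yK].
- by move=> n nu lt; rewrite [RHS]tw_TB// -xT// -yT.
Qed.

HB.instance Definition _ :=
  GRing.isZmodClosed.Build (nat -> K) Kbar_pred Kbar_zmod_closed.

Record Kbar : predArgType := MkKbar {
  Kbar_val :> nat -> K;
  Kbar_valP : Kbar_val \in Kbar_pred }.

HB.instance Definition _ := [isSub of Kbar for Kbar_val].
HB.instance Definition _ := [Choice of Kbar by <:].
HB.instance Definition _ := [SubChoice_isSubZmodule of Kbar by <:].
HB.instance Definition _ := isPointed.Build Kbar 0.

Definition seminorm_ball (i : Kbar * nat * R) : set Kbar :=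
  [set y | nrm (y i.1.2 - i.1.1 i.1.2) < i.2].

HB.instance Definition _ := isSubBaseTopological.Build Kbar
  [set i : Kbar * nat * R | 0 < i.2] seminorm_ball.

(* Borel sigma-algebra *)
HB.instance Definition _ :=
  Measurable.copy Kbar (g_sigma_algebraType (@open Kbar)).

Definition tw_level (x : K) : nat := ex_minn (tw_union x).

(* <x, y> = T(x y_n) for the least n with x in K_n. *)
Definition pairing (x : K) (y : Kbar) : K :=
  tw_T 1 (tw_level x) (x * y (tw_level x)).

Definition S0 : set Kbar :=
  [set x | forall n, (0 < n)%N ->
     nrm (x n) <= (q n)%:R `^ ((tw_d tw n)%:~R / (m n)%:R) * nrm (m n)%:R].

Definition Sn (n : nat) : set Kbar :=
  if n is 0%N then S0 else
  [set x | S0 x /\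
     nrm (x n) <= (q n)%:R `^ ((tw_d tw n)%:~R / (m n)%:R - n%:R / (tw_f tw n)%:R)
                  * nrm (m n)%:R].

End ProjectiveLimit.

Section Analysis.
Variable R : realType.

Definition cexpR (z : R[i]) : R[i] :=
  let: (a +i* b)%C := z in ((expR a * cos b) +i* (expR a * sin b))%C.

Definition Cintegral d (T : measurableType d) (mu : {measure set T -> \bar R})
    (g : T -> R[i]) : R[i] :=
  (Rintegral mu setT (fun x => complex.Re (g x)) +i*
   Rintegral mu setT (fun x => complex.Im (g x)))%C.

Variable tw : local_tower R.
Local Notation k := (tw_sub tw 1).
Local Notation abs1 := (@tw_abs R tw 1).

(* A unitary character of k = K_1 (the values of chi off k are irrelevant). *)
Record rank_zero_character (chi : tw -> R[i]) : Prop := {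
  chiD : {in k &, {morph chi : x y / x + y >-> x * y}};
  chi_unitary : {in k, forall x, `|chi x| = 1};
  chi_continuous : {in k, forall x, forall eps : R, 0 < eps ->
    exists2 delta : R, 0 < delta &
      {in k, forall y, abs1 (y - x) < delta -> `|chi y - chi x| < eps%:C%C}};
  chi_trivial : {in k, forall x, abs1 x <= 1 -> chi x = 1};
  chi_nontrivial : exists2 x, x \in k & abs1 x <= (tw_q tw 1)%:R /\ chi x != 1 }.

Definition radon (mu : {measure set (Kbar tw) -> \bar R}) : Prop :=
  (forall C : set (Kbar tw), compact C -> (mu C < +oo)%E) /\
  forall A : set (Kbar tw), measurable A ->
    mu A = ereal_sup [set mu C | C in [set C : set (Kbar tw) | compact C /\ C `<=` A]].

Record stable_semigroup (alpha : R) (chi : tw -> R[i])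
    (p : R -> probability (Kbar tw) R) : Prop := {
  sg_radon : forall t : R, 0 < t -> radon (p t);
  sg_conv : forall s t : R, 0 < s -> 0 < t -> forall A : set (Kbar tw), measurable A ->
    p (s + t) A = (\int[p s]_x p t [set y | A (x + y)%R])%E;
  sg_S : forall t : R, 0 < t -> p t (@S0 R tw) = 1%E;
  sg_fourier1 : forall t : R, 0 < t -> forall xi : tw, 1 < tw_norm xi ->
    Cintegral (p t) (fun x => chi (pairing xi x)) =
    (expR (- t * tw_norm xi `^ alpha))%:C%C;
  sg_fourier0 : forall t : R, 0 < t -> forall xi : tw, tw_norm xi <= 1 ->
    Cintegral (p t) (fun x => chi (pairing xi x)) = 1 }.

(* A Levy process X(t), t >= 0, in Kbar (values at t < 0 are irrelevant). *)
Record levy_process d (Om : measurableType d) (P : probability Om R)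
    (X : R -> Om -> Kbar tw) : Prop := {
  levy_measurable : forall t : R, 0 <= t -> measurable_fun setT (X t);
  levy_start : {ae P, forall w, X 0 w = 0};
  levy_independent : forall (N : nat) (t : nat -> R), 0 <= t 0%N ->
    (forall i, (i < N)%N -> t i <= t i.+1) ->
    forall A : nat -> set (Kbar tw), (forall i, measurable (A i)) ->
    P [set w | forall i, (i < N)%N ->
                 A i (X (t i.+1) w - X (t i) w)%R] =
    (\prod_(i < N)
      P [set w | A i (X (t i.+1) w - X (t i) w)%R])%E;
  levy_stationary : forall s h : R, 0 <= s -> 0 <= h ->
    forall A : set (Kbar tw), measurable A ->
    P [set w | A (X (s + h) w - X s w)] =
    P [set w | A (X h w)];
  levy_stoch_continuous : forall s : R, 0 <= s ->
    forall U : set (Kbar tw), open U -> U 0 ->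
    P [set w | ~ U (X t w - X s w)]
      @[t --> within [set t : R | 0 <= t] (nbhs s)] --> 0%E }.

(* A Borel measure on Kbar \ {0} is encoded as one on Kbar with no mass at 0. *)
Record levy_measure (chi : tw -> R[i]) d (Om : measurableType d)
    (P : probability Om R) (X : R -> Om -> Kbar tw)
    (Pi : {measure set (Kbar tw) -> \bar R}) : Prop := {
  lm_0 : Pi [set 0] = 0%E;
  lm_finite : forall U : set (Kbar tw), open U -> U 0 -> (Pi (~` U) < +oo)%E;
  lm_exponent : forall (lambda : tw) (t : R), 0 < t ->
    Cintegral P (fun w => chi (pairing lambda (X t w))) =
    cexpR (t%:C%C * Cintegral Pi (fun x => chi (pairing lambda x) - 1)) }.

End Analysis.

(* Main.v *)
(** Write y = x_n / m_n for a point x of the projective limit and N = n e_n. Since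
    m_n = e_n f_n, the sets S and S_n are cut out by |y|_n <= q_n^(d_n) and
    |y|_n <= q_n^(d_n - N). For lambda in K_n one has
    chi(<lambda, x>) = phi(lambda y) with phi = chi o Tr_(K_n/k), and the
    definition of the different says that {|y|_n <= q_n^(d_n)} is exactly the
    dual of the ring of integers O_n under phi. Hence, for x in S, averaging
    1 - Re phi(lambda y) over representatives lambda of p^(-N) / O_n gives the
    indicator function of S \ S_n. Integrating against Pi turns the left-hand
    side into an average of ||lambda||^alpha, that is, into a geometric sum,
    because p^(-N) / O_n has q_n^j - q_n^(j-1) classes with |lambda|_n = q_n^j
    for each 0 < j <= N.
    That Pi is carried by S comes from the same averaging, over the residue field:
    the integral of 1 - Re phi(lambda y) vanishes when ||lambda|| <= 1. *)
From HB Require Import structures.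
Require Import Defs.
From mathcomp Require Import all_boot all_order all_algebra.
From mathcomp Require Import all_classical all_reals all_analysis measurable_realfun.
From mathcomp Require Import complex ring lra zify.

Set Implicit Arguments.
Unset Strict Implicit.
Unset Printing Implicit Defensive.

Import Order.TTheory GRing.Theory Num.Theory.
Import numFieldNormedType.Exports.

Local Open Scope classical_set_scope.
Local Open Scope ring_scope.

(** * Bases and traces over subfields *)

Section SubfieldLinearAlgebra.
Variable K : fieldType.
Implicit Types F E : divringClosed K.

Section Carrier.
Variable F : divringClosed K.

Record carrier : predArgType := Carrier {
  carrier_val : K; carrier_valP : carrier_val \in F }.

HB.instance Definition _ := [isSub for carrier_val].
HB.instance Definition _ := [Choice of carrier by <:].
HB.instance Definition _ := [SubChoice_isSubComUnitRing of carrier by <:].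
HB.instance Definition _ := [SubComUnitRing_isSubIntegralDomain of carrier by <:].
HB.instance Definition _ := [SubIntegralDomain_isSubField of carrier by <:].

End Carrier.

Lemma left_kernel_over F p d (A : 'M[K]_(p, d)) :
  A \is a mxOver F -> (d < p)%N ->
  exists c : 'rV[K]_p, [/\ c \is a mxOver F, c != 0 & c *m A = 0].
Proof.
move=> /mxOverP AF ltdp.
pose B : 'M[carrier F]_(p, d) := \matrix_(i, j) Carrier (AF i j).
have AB : A = map_mx val B by apply/matrixP => i j; rewrite !mxE.
have : kermx B != 0.
  rewrite kermx_eq0 /row_free; apply: contraTneq (rank_leq_col B) => ->.
  by rewrite -ltnNge.
case/rowV0Pn => v /sub_kermxP vB vn0.
exists (map_mx val v); split.
- by apply/mxOverP => i j; rewrite mxE; exact: valP.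
- by rewrite map_mx_eq0.
- by rewrite AB -map_mxM vB map_mx0.
Qed.

Lemma basis_dependent F E d (b : 'cV[K]_d) p (v : 'cV[K]_p) :
  is_basis F E b -> v \is a mxOver E -> (d < p)%N ->
  exists c : 'rV[K]_p, [/\ c \is a mxOver F, c != 0 & c *m v = 0].
Proof.
move=> bb vE ltdp; have [A AF ->] := basis_coordmx bb vE.
have [c [cF cn0 cA]] := left_kernel_over AF ltdp.
by exists c; split; rewrite // mulmxA cA mul0mx.
Qed.

Lemma basis_free F E d (b : 'cV[K]_d) (c : 'rV[K]_d) :
  is_basis F E b -> c \is a mxOver F -> c *m b = 0 -> c = 0.
Proof.
move=> [_ /(_ 0 (rpred0 _))[c0 [_ uc]]] cF cb.
have e0 : 0 = 0%:M :> 'M[K]_1 by apply/matrixP => i j; rewrite !mxE mul0rn.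
transitivity c0; last by apply: uc; rewrite mul0mx rpred0.
by apply/esym/uc; rewrite cb.
Qed.

Lemma basis1 F E : E =i F -> is_basis F E (1%:M : 'cV[K]_1).
Proof.
move=> EF; split=> [|x xE]; first by rewrite mxOver_scalar ?rpred0 ?rpred1.
exists x%:M; split=> [|c [_]]; last by rewrite mulmx1.
by rewrite mulmx1 mxOver_scalar ?rpred0 -?EF.
Qed.

Lemma has_degree_gt0 F E d : has_degree F E d -> (0 < d)%N.
Proof.
case=> b [_ /(_ 1 (rpred1 _))[c [[_ +] _]]]; case: d b c => // b c.
rewrite (thinmx0 c) mul0mx => /matrixP/(_ 0 0)/eqP.
by rewrite !mxE eqxx eq_sym oner_eq0.
Qed.

Lemma has_degree_self F E d : E =i F -> has_degree F E d -> d = 1%N.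
Proof.
move=> EF [b bb]; apply/eqP; rewrite eqn_leq (has_degree_gt0 (ex_intro _ b bb)).
rewrite andbT leqNgt; apply/negP => d1.
have [c [cF + cb]] := basis_dependent (basis1 EF) bb.1 d1.
by rewrite (basis_free bb cF cb) eqxx.
Qed.

Lemma has_degree_lt F E E' d d' x :
  {subset E <= E'} -> x \in E' -> x \notin E ->
  has_degree F E d -> has_degree F E' d' -> {subset F <= E} -> (d < d')%N.
Proof.
move=> EE' xE' xnE [b bb] [b' bb'] FE; rewrite ltnNge; apply/negP => d'd.
pose v : 'cV[K]_(d + 1) := col_mx b x%:M.
have vE' : v \is a mxOver E'.
  apply/mxOverP => i j; rewrite ord1 mxE; case: splitP => k _.
    by apply: EE'; exact: (mxOverP bb.1 k 0).
  by rewrite !ord1 mxE eqxx.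
have [|c [cF cn0 cv]] := basis_dependent bb' vE'; first by rewrite addn1 ltnS.
have cFi := mxOverP cF; move: cv.
rewrite -[c]hsubmxK /v mul_row_col; set c1 := lsubmx c; set c2 := rsubmx c => cv.
have c1F : c1 \is a mxOver F by apply/mxOverP => i j; rewrite mxE.
have c2F : c2 0 0 \in F by rewrite mxE.
have c20 : c2 0 0 = 0.
  apply/eqP; apply: contraNT xnE => c2n0.
  have -> : x = (c2 0 0)^-1 * - (c1 *m b) 0 0.
    move/matrixP/(_ 0 0): cv; rewrite [in X in X -> _]mxE [X in _ + X]mxE big_ord1.
    rewrite [x%:M 0 0]mxE eqxx mulr1n [X in _ = X]mxE => /eqP.
    rewrite addr_eq0 => /eqP ->; rewrite opprK mulKf//.
  apply: rpredM; first by rewrite rpredV; exact: FE.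
  rewrite rpredN mxE; apply: rpred_sum => i _; apply: rpredM.
    by apply: FE; exact: (mxOverP c1F 0 i).
  exact: (mxOverP bb.1 i 0).
have c2E : c2 = 0 by apply/matrixP => i j; rewrite !ord1 c20 mxE.
have c1E : c1 = 0.
  by apply: (basis_free bb c1F); move: cv; rewrite c2E mul0mx addr0.
by move: cn0; rewrite -[c]hsubmxK -/c1 -/c2 c1E c2E row_mx0 eqxx.
Qed.

Lemma field_trace_sub F E x : field_trace F E x \in F.
Proof.
rewrite /field_trace; case: xgetP => [y _ [d [b [A [_ /mxOverP AF _ ->]]]]|_].
  by apply: rpred_sum => i _; exact: AF.
exact: rpred0.
Qed.

Lemma field_trace_id F E : E =i F -> {in E, field_trace F E =1 id}.
Proof.
move=> EF x xE; apply: field_traceE => [y|]; first by rewrite EF.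
exists 1%N, 1%:M, x%:M; split; first exact: basis1.
- by rewrite mxOver_scalar ?rpred0 -?EF.
- by rewrite mulmx1 scalemx1.
- by rewrite mxtrace_scalar.
Qed.

Lemma field_traceZ F E d c x : {subset F <= E} -> has_degree F E d ->
  c \in F -> x \in E -> field_trace F E (c * x) = c * field_trace F E x.
Proof.
move=> FE [b bb] cF xE.
have [|A AF xA] := basis_coordmx bb (_ : x *: b \is a mxOver E).
  by apply/mxOverP => i j; rewrite mxE rpredM// (mxOverP bb.1).
rewrite (field_traceE FE (_ : is_trace F E x (\tr A))); last by exists d, b, A.
apply: field_traceE => //; exists d, b, (c *: A); split=> //.
- by apply/mxOverP => i j; rewrite mxE rpredM// (mxOverP AF).
- by rewrite -scalerA xA scalemxAl.
- by rewrite mxtraceZ.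
Qed.

Lemma field_traceD F E : {subset F <= E} ->
  {in E &, {morph field_trace F E : x y / x + y}}.
Proof.
move=> FE x y xE yE; have TB := field_traceB FE.
have T0 : field_trace F E 0 = 0 by have := TB 0 0 (rpred0 _) (rpred0 _); rewrite !subrr.
have -> : x + y = x - (0 - y) by rewrite sub0r opprK.
by rewrite !TB ?rpredB ?rpred0// T0 sub0r opprK.
Qed.

End SubfieldLinearAlgebra.

(** * Normalized absolute values and sums over residues *)

Section NormalizedAbs.
Variables (R : realType) (K : fieldType) (E : divringClosed K) (a : K -> R).
Variables (q : nat) (ha : normalized_abs E a q).
Local Notation Q := (q%:R : R).

Lemma nabs0 : a 0 = 0.
Proof. by apply/eqP; rewrite (nabs_eq0 ha) ?rpred0. Qed.

Lemma nabs_gt0 x : x \in E -> x != 0 -> 0 < a x.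
Proof. by move=> xE x0; rewrite lt0r (nabs_eq0 ha)// x0 (nabs_ge0 ha). Qed.

Lemma nabs1 : a 1 = 1.
Proof.
have E1 : 1 \in E := rpred1 _.
have a1 : a 1 != 0 by rewrite (nabs_eq0 ha) ?oner_eq0.
by apply: (mulfI a1); rewrite -(nabsM ha E1 E1) !mulr1.
Qed.

Lemma nabsN : {in E, forall x, a (- x) = a x}.
Proof.
move=> x xE; have EN1 : -1 \in E by rewrite rpredN1.
have aN1 : a (-1) = 1.
  apply/eqP; rewrite -(@eqrXn2 _ 2) ?(nabs_ge0 ha)//.
  by rewrite expr2 -(nabsM ha)// mulrNN mulr1 nabs1 expr1n.
by rewrite -mulN1r (nabsM ha)// aN1 mul1r.
Qed.

Lemma nabsV : {in E, forall x, a x^-1 = (a x)^-1}.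
Proof.
move=> x xE; have [->|x0] := eqVneq x 0; first by rewrite invr0 nabs0 invr0.
apply: (mulfI (lt0r_neq0 (nabs_gt0 xE x0))).
by rewrite -(nabsM ha) ?rpredV// !divff ?nabs1// gt_eqF ?nabs_gt0.
Qed.

Lemma nabsX n : {in E, forall x, a (x ^+ n) = a x ^+ n}.
Proof.
move=> x xE; elim: n => [|n IH]; first by rewrite !expr0 nabs1.
by rewrite !exprS (nabsM ha) ?rpredX// IH.
Qed.

Lemma nabs_leD x y r : x \in E -> y \in E -> a x <= r -> a y <= r -> a (x + y) <= r.
Proof.
by move=> xE yE xr yr; apply: le_trans (nabsD ha xE yE) _; rewrite ge_max xr.
Qed.

Lemma nabs_leB x y r : x \in E -> y \in E -> a x <= r -> a y <= r -> a (x - y) <= r.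
Proof. by move=> xE yE xr yr; rewrite nabs_leD ?rpredN ?nabsN. Qed.

Lemma nabs_ltD x y r : x \in E -> y \in E -> a x < r -> a y < r -> a (x + y) < r.
Proof.
by move=> xE yE xr yr; apply: le_lt_trans (nabsD ha xE yE) _; rewrite gt_max xr.
Qed.

Lemma nabs_ltB x y r : x \in E -> y \in E -> a x < r -> a y < r -> a (x - y) < r.
Proof. by move=> xE yE xr yr; rewrite nabs_ltD ?rpredN ?nabsN. Qed.

Lemma nabs_dominant x y : x \in E -> y \in E -> a x < a y -> a (x + y) = a y.
Proof.
move=> xE yE xy; apply/eqP; rewrite eq_le nabs_leD ?(ltW xy)//= leNgt.
apply/negP => lt; suff : a y < a y by rewrite ltxx.
by rewrite -{1}[y](addKr x) addrC nabs_ltB ?rpredD.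
Qed.

Lemma nabs_card_gt1 : (1 < q)%N.
Proof.
have [r [rE rinj rsurj]] := nabs_residue ha.
have a0 : a 0 <= 1 by rewrite nabs0.
have a1 : a 1 <= 1 by rewrite nabs1.
have [i hi] := rsurj 0 (rpred0 _) a0.
have [j hj] := rsurj 1 (rpred1 _) a1.
have ij : i != j.
  apply/eqP => ij; move: hj; rewrite -ij ltNge => /negP; apply.
  rewrite [1 - _]addrC nabs_dominant ?rpred1 ?nabs1//.
  - by rewrite rpredN (rE i).1.
  - by rewrite -[- _]sub0r.
rewrite ltnNge; apply: contra ij => q1; apply/eqP/val_inj => /=.
by have := ltn_ord i; have := ltn_ord j; lia.
Qed.

Lemma nabs_base_gt1 : 1 < Q. Proof. by rewrite ltr1n nabs_card_gt1. Qed.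

Lemma nabs_base_gt0 : 0 < Q. Proof. exact: lt_trans ltr01 nabs_base_gt1. Qed.

Lemma nabs_base_unit : Q \is a GRing.unit.
Proof. by rewrite unitfE gt_eqF ?nabs_base_gt0. Qed.

Lemma nabs_lt_le x (z : int) : x \in E -> a x < Q ^ (z + 1) -> a x <= Q ^ z.
Proof.
move=> xE; have [->|x0] := eqVneq x 0.
  by move=> _; rewrite nabs0 exprz_ge0// ltW ?nabs_base_gt0.
have [w ->] := nabs_value ha xE x0.
by rewrite (ltr_eXz2l nabs_base_gt1) (ler_eXz2l nabs_base_gt1) ltzD1.
Qed.

Lemma nabs_lt1 x : x \in E -> a x < 1 -> a x <= Q ^ (-1).
Proof. by move=> xE x1; rewrite nabs_lt_le// addNr expr0z. Qed.

Lemma nabs_gt_exp x (z : int) : x \in E -> Q ^ z < a x ->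
  exists2 j : nat, (0 < j)%N & a x = Q ^ (z + j%:Z).
Proof.
move=> xE; have [->|x0] := eqVneq x 0.
  by rewrite nabs0 ltNge exprz_ge0// ltW ?nabs_base_gt0.
have [w ->] := nabs_value ha xE x0; rewrite (ltr_eXz2l nabs_base_gt1) => zw.
by exists `|w - z|%N; [lia | congr (_ ^ _); lia].
Qed.

Lemma nabs_exists (z : int) : exists x, [/\ x \in E, x != 0 & a x = Q ^ z].
Proof.
have [p pE ap] := nabs_uniformizer ha.
have p0 : p != 0.
  by rewrite -(nabs_eq0 ha)// ap invr_eq0 gt_eqF ?nabs_base_gt0.
have ex (n : nat) : a (p ^+ n) = Q ^ (- n%:Z) by rewrite nabsX// ap -exprz_inv.
have pX n : p ^+ n \in E by rewrite rpredX.
case: z => n.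
  by exists (p ^- n); rewrite invr_eq0 expf_neq0// rpredV pX nabsV// ex invr_expz opprK.
by exists (p ^+ n.+1); rewrite expf_neq0// pX ex NegzE.
Qed.

Definition residue_system (r : 'I_q -> K) : Prop :=
  [/\ forall i, r i \in E /\ a (r i) <= 1,
      forall i j, a (r i - r j) < 1 -> i = j &
      forall x, x \in E -> a x <= 1 -> exists i, a (x - r i) < 1].

Lemma residue_system0 : exists r i0,
  [/\ residue_system r, r i0 = 0 & forall i, i != i0 -> a (r i) = 1].
Proof.
have [r [rE rinj rsurj]] := nabs_residue ha.
have a0 : a 0 <= 1 by rewrite nabs0.
have [i0 hi0] := rsurj 0 (rpred0 _) a0.
pose s i := if i == i0 then 0 else r i.
have rs i : a (r i - s i) < 1.
  rewrite /s; case: ifP => [/eqP ->|_]; last by rewrite subrr nabs0 ltr01.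
  by rewrite subr0 -nabsN ?(rE _).1// -sub0r.
have sE i : s i \in E by rewrite /s; case: ifP => _; rewrite ?rpred0// (rE i).1.
have rE' i := (rE i).1.
exists s, i0; split; last 2 first.
- by rewrite /s eqxx.
- move=> i ii0; apply/eqP; rewrite /s (negPf ii0) eq_le (rE i).2 leNgt.
  apply: contra ii0 => ri1; apply/eqP/rinj.
  by rewrite nabs_ltB// -nabsN// -sub0r.
split=> [i|i j sij|x xE x1].
- by split=> //; rewrite /s; case: ifP => // _; exact: (rE i).2.
- apply: rinj.
  have -> : r i - r j = (r i - s i) + (s i - s j) - (r j - s j) by ring.
  apply: nabs_ltB => //; [by apply: rpredD; exact: rpredB|exact: rpredB|].
  by apply: nabs_ltD => //; exact: rpredB.
- have [i xi] := rsurj x xE x1; exists i.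
  have -> : x - s i = (x - r i) + (r i - s i) by ring.
  by rewrite nabs_ltD ?rpredB.
Qed.

(* If r is a residue system and w a uniformizer, these sums
   \sum_(1 <= l <= N) r_(i_l) w^(-l) represent p^(-N) modulo the integers. *)
Fixpoint digits (r : 'I_q -> K) (w : K) (N : nat) : seq K :=
  if N is N'.+1 then [seq x + r i * w ^- N | x <- digits r w N', i <- enum 'I_q]
  else [:: 0].

Section Digits.
Variable r : 'I_q -> K.
Hypothesis hr : residue_system r.

Let rE i : r i \in E. Proof. by case: hr => /(_ i)[]. Qed.
Let r1 i : a (r i) <= 1. Proof. by case: hr => /(_ i)[]. Qed.

Variables (phi : K -> R[i]) (d : int).
Hypothesis phiD : {in E &, {morph phi : x y / x + y >-> x * y}}.
Hypothesis phi1 : forall y, y \in E -> a y <= Q ^ d -> phi y = 1.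
Hypothesis phin1 : forall y, y \in E -> Q ^ d < a y ->
  exists2 c, c \in E /\ a c <= 1 & phi (c * y) != 1.

Lemma sum_residue_trivial z : z \in E -> a z <= Q ^ d ->
  \sum_i phi (r i * z) = q%:R.
Proof.
move=> zE az; rewrite (eq_bigr (fun=> 1)) => [|i _].
  by rewrite sumr_const card_ord.
rewrite phi1 ?rpredM// (nabsM ha)//; apply: le_trans az.
by rewrite ler_piMl// (nabs_ge0 ha).
Qed.

Lemma sum_residue_nontrivial z : z \in E -> a z = Q ^ (d + 1) ->
  \sum_i phi (r i * z) = 0.
Proof.
move=> zE az; have [|c [cE c1] pc] := phin1 zE.
  by rewrite az (ltr_eXz2l nabs_base_gt1); lia.
have [_ rinj rsurj] := hr.
have /choice[s hs] : forall i, exists j, a (c + r i - r j) < 1.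
  by move=> i; apply: rsurj; rewrite ?rpredD// nabs_leD.
have sinj : injective s.
  move=> i j sij; apply: rinj.
  have -> : r i - r j = (c + r i - r (s i)) - (c + r j - r (s j)) by rewrite sij; ring.
  by rewrite nabs_ltB ?rpredB ?rpredD.
have eqs i : phi (c * z) * phi (r i * z) = phi (r (s i) * z).
  rewrite -phiD ?rpredM//.
  have -> : c * z + r i * z = (c + r i - r (s i)) * z + r (s i) * z by ring.
  have uE : c + r i - r (s i) \in E by rewrite rpredB ?rpredD.
  rewrite phiD ?rpredM// phi1 ?mul1r ?rpredM// (nabsM ha)// az.
  have -> : Q ^ d = Q ^ (-1) * Q ^ (d + 1).
    by rewrite -exprzDr ?nabs_base_unit//; congr (_ ^ _); lia.
  by rewrite ler_wpM2r ?exprz_ge0 ?(ltW nabs_base_gt0)// nabs_lt1.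
have : phi (c * z) * (\sum_i phi (r i * z)) = \sum_i phi (r i * z).
  rewrite mulr_sumr [RHS](reindex_inj sinj); apply: eq_bigr => i _; exact: eqs.
move/eqP; rewrite -subr_eq0 -{2}[\sum_i _]mul1r -mulrBl mulf_eq0 subr_eq0.
by rewrite (negPf pc) => /eqP.
Qed.

Variables (w : K) (i0 : 'I_q).
Hypotheses (wE : w \in E) (aw : a w = Q^-1).
Hypotheses (ri0 : r i0 = 0) (ri1 : forall i, i != i0 -> a (r i) = 1).

Let awN N : a (w ^- N) = Q ^ N%:Z.
Proof. by rewrite nabsV ?rpredX// nabsX// aw exprVn invrK. Qed.

Let wNE N : w ^- N \in E. Proof. by rewrite rpredV rpredX. Qed.

Lemma digitsP N x : x \in digits r w N -> x \in E /\ a x <= Q ^ N%:Z.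
Proof.
elim: N x => [|N IH] x /=; first by rewrite inE => /eqP->; rewrite rpred0 nabs0 ler01.
case/allpairsP => -[y i] /= [/IH[yE ay] _ ->]; split.
  by rewrite rpredD// rpredM.
rewrite nabs_leD ?rpredM//.
  by apply: le_trans ay _; rewrite (ler_eXz2l nabs_base_gt1) lez_nat.
by rewrite (nabsM ha)// awN ler_piMl// exprz_ge0// ltW ?nabs_base_gt0.
Qed.

Lemma size_digits N : size (digits r w N) = (q ^ N)%N.
Proof. by elim: N => //= N IH; rewrite size_allpairs IH size_enum_ord expnSr. Qed.

Lemma sum_digits_norm (F : R -> R) N :
  \sum_(x <- digits r w N) (if a x <= 1 then 0 else F (a x)) =
  \sum_(l < N) (q%:R - 1) * Q ^+ l * F (Q ^+ l.+1).
Proof.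
elim: N => [|N IH]; first by rewrite big_seq1 big_ord0 nabs0 ler01.
rewrite big_ord_recr /= -IH.
rewrite (@big_allpairs_dep _ _ _ _ _ _ (fun x i => x + r i * w ^- N.+1)) /=.
rewrite exchange_big /= big_enum (bigD1 i0)//=; congr (_ + _).
  by apply: eq_bigr => x _; rewrite ri0 mul0r addr0.
rewrite (eq_bigr (fun=> Q ^+ N * F (Q ^+ N.+1))) => [|i ii0].
  rewrite sumr_const cardC1 card_ord -mulrA -[LHS]mulr_natl -subn1.
  by rewrite natrB// ltnW ?nabs_card_gt1.
rewrite (eq_big_seq (fun=> F (Q ^+ N.+1))) => [|x /digitsP[xE ax]].
  by rewrite big_const_seq count_predT size_digits iter_addr_0 -[LHS]mulr_natl natrX.
have ari : a (r i * w ^- N.+1) = Q ^+ N.+1 by rewrite (nabsM ha)// awN ri1// mul1r.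
have -> : a (x + r i * w ^- N.+1) = Q ^+ N.+1.
  rewrite nabs_dominant ?rpredM// ari; apply: le_lt_trans ax _.
  by rewrite (ltr_eXz2l nabs_base_gt1 N N.+1) ltz_nat.
by rewrite leNgt exprn_egt1// nabs_base_gt1.
Qed.

Lemma sum_digits_char N y : y \in E -> a y <= Q ^ d ->
  \sum_(x <- digits r w N) phi (x * y) =
  if a y <= Q ^ (d - N%:Z) then (q ^ N)%:R else 0.
Proof.
move=> yE ay; elim: N => [|N IH].
  by rewrite big_seq1 mul0r phi1 ?rpred0 ?nabs0 ?exprz_ge0 ?(ltW nabs_base_gt0)// subr0 ay.
have -> : \sum_(x <- digits r w N.+1) phi (x * y) =
    (\sum_(x <- digits r w N) phi (x * y)) * \sum_i phi (r i * (w ^- N.+1 * y)).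
  rewrite /= (@big_allpairs_dep _ _ _ _ _ _ (fun x i => x + r i * w ^- N.+1)) /=.
  rewrite mulr_suml big_seq [RHS]big_seq; apply: eq_bigr => x /digitsP[xE _].
  rewrite big_enum mulr_sumr; apply: eq_bigr => i _.
  by rewrite mulrDl -mulrA phiD ?rpredM.
have zE : w ^- N.+1 * y \in E by rewrite rpredM.
have az : a (w ^- N.+1 * y) = Q ^ N.+1%:Z * a y by rewrite (nabsM ha)// awN.
have Qd : Q ^ d = Q ^ N.+1%:Z * Q ^ (d - N.+1%:Z).
  by rewrite -exprzDr ?nabs_base_unit// addrCA subrr addr0.
have QN0 : 0 < Q ^ N.+1%:Z by rewrite exprz_gt0 ?nabs_base_gt0.
rewrite IH; case: (leP (a y) (Q ^ (d - N.+1%:Z))) => [ayN|].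
  rewrite (le_trans ayN) ?(ler_eXz2l nabs_base_gt1); last by lia.
  by rewrite sum_residue_trivial// ?expnSr ?natrM// az Qd ler_wpM2l// ltW.
case/nabs_gt_exp => // -[//|j] _ ayj.
case: ifP => [|_]; last by rewrite mul0r.
rewrite ayj (ler_eXz2l nabs_base_gt1) => j0.
rewrite sum_residue_nontrivial ?mulr0// az ayj -exprzDr ?nabs_base_unit//.
by congr (_ ^ _); lia.
Qed.

End Digits.

End NormalizedAbs.

Lemma ler_powR2r (R : realType) (r x y : R) : 0 < r -> 0 <= x -> 0 <= y ->
  (x `^ r <= y `^ r) = (x <= y).
Proof.
move=> r0 x0 y0; apply/idP/idP => [|xy].
  by apply: contraTT; rewrite -!ltNge => yx; exact: gt0_ltr_powR.
by apply: ge0_ler_powR => //; rewrite ?nnegrE ?ltW.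
Qed.

(** * Arithmetic and topology of the tower *)

Section Tower.
Variables (R : realType) (tw : local_tower R).
Local Notation K := (tw_field tw).
Local Notation Kn := (tw_sub tw).
Local Notation abs := (@tw_abs R tw).
Local Notation nrm := (@tw_norm R tw).
Local Notation m := (tw_m tw).
Local Notation q := (tw_q tw).
Local Notation e := (tw_e tw).
Local Notation f := (tw_f tw).
Local Notation d := (tw_d tw).
Local Notation Q n := ((q n)%:R : R).
Local Notation absP := (tw_absP tw).

Lemma tw_m1 : m 1 = 1%N.
Proof. exact: has_degree_self (tw_mP tw 1). Qed.

Lemma tw_m0 : m 0 = 1%N.
Proof. exact: has_degree_self (@tw_sub0 _ tw) (tw_mP tw 0). Qed.

Lemma tw_m_gt0 n : (0 < m n)%N.
Proof. exact: has_degree_gt0 (tw_mP tw n). Qed.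

Lemma tw_sub1 n : {subset Kn 1 <= Kn n}.
Proof. by case: n => [|n]; [move=> x; rewrite tw_sub0|exact: tw_sub_le]. Qed.

Lemma tw_m_ge n : (n <= m n)%N.
Proof.
elim: n => // -[_|n IH]; first by rewrite tw_m1.
have [sub [x xE xnE]] := tw_subS tw (ltn0Sn n).
apply: leq_ltn_trans IH _.
exact: has_degree_lt sub xE xnE (tw_mP tw _) (tw_mP tw _) (@tw_sub1 _).
Qed.

Lemma tw_natr_neq0 n : (0 < n)%N -> n%:R != 0 :> K.
Proof.
case: (tw_local tw) => char0 _ _ n0.
by move: (pcharf0P K) => [/(_ char0)->//]; rewrite -lt0n.
Qed.

(* [tw_norm] is one function on the whole tower, so the formula of [tw_normP] at
   level n must agree with the one at level 1. *)
Lemma tw_abs1E n x : x \in Kn 1 -> abs n x = abs 1 x ^+ m n.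
Proof.
move=> x1; have xn := tw_sub1 n x1.
have mn0 : (m n)%:R != 0 :> R by rewrite pnatr_eq0 -lt0n tw_m_gt0.
rewrite -powR_mulrn ?(nabs_ge0 (absP 1))//.
have -> : abs 1 x = nrm x.
  by rewrite (tw_normP x1) tw_m1 invr1 powRr1// (nabs_ge0 (absP 1)).
by rewrite (tw_normP xn) -powRrM mulVf// powRr1// (nabs_ge0 (absP n)).
Qed.

Lemma tw_q_ramified n : (q n ^ e n = q 1 ^ m n)%N.
Proof.
have [x x1 ax] := nabs_uniformizer (absP 1).
have := tw_eP n x1 ax; rewrite tw_abs1E// ax exprVn => /invr_inj.
by rewrite -!natrX => /eqP; rewrite eqr_nat => /eqP.
Qed.

Lemma tw_q_inert n : (q n = q 1 ^ f n)%N.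
Proof.
have [r [rE rinj rsurj]] := nabs_residue (absP 1).
have [s [sE sinj ssurj]] := nabs_residue (absP n).
have [u [uE ugen ufree]] := tw_fP tw n.
have small x : x \in Kn 1 -> (abs n x < 1) = (abs 1 x < 1).
  by move=> x1; rewrite tw_abs1E// expr_lt1 ?(nabs_ge0 (absP 1))// tw_m_gt0.
have le1 x : x \in Kn 1 -> abs 1 x <= 1 -> abs n x <= 1.
  by move=> x1 ax; rewrite tw_abs1E// exprn_ile1 ?(nabs_ge0 (absP 1)).
have rE1 i := (rE i).1; have sE1 i := (sE i).1; have uE1 i := (uE i).1.
have rEn i : r i \in Kn n := tw_sub1 n (rE1 i).
pose comb (c : 'I_(f n) -> K) := \sum_i c i * u i.
have combE c : (forall i, c i \in Kn n /\ abs n (c i) <= 1) ->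
    comb c \in Kn n /\ abs n (comb c) <= 1.
  move=> cE; apply: (big_ind (fun x => x \in Kn n /\ abs n x <= 1)).
  - by rewrite rpred0 (nabs0 (absP n)).
  - by move=> x y [xE x1] [yE y1]; rewrite rpredD// (nabs_leD (absP n)).
  - move=> i _; rewrite rpredM ?(cE i).1//; split=> //.
    have [ciE ci1] := cE i; rewrite (nabsM (absP n))//.
    by rewrite mulr_ile1 ?(nabs_ge0 (absP n)) ?(uE i).2.
have combS c : (forall i, c i \in Kn n /\ abs n (c i) < 1) -> abs n (comb c) < 1.
  move=> cE; suff [] : comb c \in Kn n /\ abs n (comb c) < 1 by [].
  apply: (big_ind (fun x => x \in Kn n /\ abs n x < 1)).
  - by rewrite rpred0 (nabs0 (absP n)).
  - by move=> x y [xE x1] [yE y1]; rewrite rpredD// (nabs_ltD (absP n)).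
  - move=> i _; have [ciE ci1] := cE i; rewrite rpredM//; split=> //.
    rewrite (nabsM (absP n))//; apply: le_lt_trans ci1.
    by rewrite ler_piMr ?(nabs_ge0 (absP n)) ?(uE i).2.
have /choice[t ht] : forall c : {ffun 'I_(f n) -> 'I_(q 1)},
    exists j, abs n (comb (r \o c) - s j) < 1.
  move=> c; have [|cE c1] := combE (r \o c).
    by move=> i /=; rewrite rEn le1 ?(rE _).2.
  exact: ssurj.
have combB c c' : comb c - comb c' = comb (fun i => c i - c' i).
  by rewrite /comb -sumrB; apply: eq_bigr => i _; rewrite mulrBl.
have tinj : injective t.
  move=> c c' tc; apply/ffunP => i; apply: rinj; move: i.
  apply: ufree => [i|].
    rewrite rpredB//; split=> //.
    by rewrite (nabs_leB (absP 1)) ?(rE _).2.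
  rewrite -/(comb (fun i => r (c i) - r (c' i))) -combB.
  have [cE c1] : comb (r \o c) \in Kn n /\ abs n (comb (r \o c)) <= 1.
    by apply: combE => i /=; rewrite rEn le1 ?(rE _).2.
  have [c'E c'1] : comb (r \o c') \in Kn n /\ abs n (comb (r \o c')) <= 1.
    by apply: combE => i /=; rewrite rEn le1 ?(rE _).2.
  rewrite (_ : _ - _ = (comb (r \o c) - s (t c)) - (comb (r \o c') - s (t c'))).
    by apply: (nabs_ltB (absP n)) => //; exact: rpredB.
  by rewrite tc; ring.
have tsurj j : exists c, t c = j.
  have [c cE cj] := ugen (s j) (sE j).1 (sE j).2.
  have /choice[c' hc'] : forall i, exists k, abs 1 (c i - r k) < 1.
    by move=> i; apply: rsurj; [exact: (cE i).1|exact: (cE i).2].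
  exists [ffun i => c' i]; apply: sinj.
  have cEn i : c i \in Kn n := tw_sub1 n (cE i).1.
  have [cbE _] : comb c \in Kn n /\ abs n (comb c) <= 1.
    by apply: combE => i; rewrite cEn le1 ?(cE i).1 ?(cE i).2.
  have [c'E c'1] : comb (r \o [ffun i => c' i]) \in Kn n /\
      abs n (comb (r \o [ffun i => c' i])) <= 1.
    by apply: combE => i /=; rewrite rEn le1 ?(rE _).2.
  pose x := comb (r \o [ffun i => c' i]).
  rewrite (_ : _ - _ = (x - comb c) - (s j - comb c) - (x - s (t [ffun i => c' i])));
    last by ring.
  have xE := rpredB c'E (sE1 (t [ffun i => c' i])).
  have jE := rpredB (sE1 j) cbE.
  have xcE := rpredB c'E cbE.
  apply: (nabs_ltB (absP n)); rewrite ?rpredB//; last exact: ht.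
  apply: (nabs_ltB (absP n)); rewrite ?rpredB//; rewrite combB; apply: combS => i /=.
  rewrite ffunE rpredB//; split=> //.
  rewrite small ?rpredB//; last exact: (cE i).1.
  rewrite -(nabsN (absP 1)) ?opprB// rpredB//; exact: (cE i).1.
have /choice[g gK] := tsurj.
have ginj : injective g by move=> j j' gj; rewrite -(gK j) -(gK j') gj.
have := leq_card _ tinj; have := leq_card _ ginj.
rewrite card_ffun !card_ord => h1 h2.
by apply/eqP; rewrite eqn_leq h1.
Qed.

(* The fundamental identity, obtained from q_1^(m_n) = q_n^(e_n) = q_1^(e_n f_n)
   without using completeness. *)
Lemma tw_m_ef n : m n = (e n * f n)%N.
Proof.
have q1 := nabs_card_gt1 (absP 1); apply/eqP; rewrite mulnC -(eqn_exp2l _ _ q1).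
by rewrite expnM -tw_q_inert tw_q_ramified.
Qed.

Lemma tw_e_gt0 n : (0 < e n)%N.
Proof. by have := tw_m_gt0 n; rewrite tw_m_ef muln_gt0 => /andP[]. Qed.

Lemma tw_f_gt0 n : (0 < f n)%N.
Proof. by have := tw_m_gt0 n; rewrite tw_m_ef muln_gt0 => /andP[]. Qed.


(* In terms of y = x_n / m_n, the annihilator of {|l|_n <= q_n^j} under the pairing
   (l, y) |-> chi (Tr (l y)). *)
Definition dual_ball (n : nat) (j : int) : set (Kbar tw) :=
  [set x | abs n (x n / (m n)%:R) <= Q n ^ (d n - j)].

Lemma Kbar_in n (x : Kbar tw) : x n \in Kn n.
Proof. by have /asboolP[] := Kbar_valP x. Qed.

Lemma coord_in n (x : Kbar tw) : x n / (m n)%:R \in Kn n.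
Proof. by rewrite rpred_div ?Kbar_in ?rpred_nat. Qed.

Lemma dual_ball_le n i j : i <= j -> dual_ball n j `<=` dual_ball n i.
Proof.
move=> ij x; rewrite /dual_ball /= => /le_trans; apply.
by rewrite (ler_eXz2l (nabs_base_gt1 (absP n))) lerB.
Qed.

Lemma dual_ball_norm n j (x : Kbar tw) :
  dual_ball n j x <->
  nrm (x n) <= Q n `^ ((d n - j)%:~R / (m n)%:R) * nrm (m n)%:R.
Proof.
have mK : (m n)%:R \in Kn n by exact: rpred_nat.
have mn0 : (m n)%:R != 0 :> K by rewrite tw_natr_neq0 ?tw_m_gt0.
have am : 0 < abs n (m n)%:R by rewrite (nabs_gt0 (absP n)).
have Q0 := nabs_base_gt0 (absP n).
rewrite /dual_ball /= (nabsM (absP n)) ?rpredV ?Kbar_in// (nabsV (absP n))//.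
rewrite ler_pdivrMr// !(tw_normP (n := n)) ?Kbar_in//.
rewrite powRrM powR_intmul ?(ltW Q0)// -powRM ?exprz_ge0 ?(ltW Q0) ?(ltW am)//.
rewrite ler_powR2r ?invr_gt0 ?ltr0n ?tw_m_gt0 ?(nabs_ge0 (absP n)) ?Kbar_in//.
by rewrite mulr_ge0 ?exprz_ge0 ?ltW.
Qed.

Lemma S0E : @S0 R tw = \bigcap_(n in [set n | (0 < n)%N]) dual_ball n 0.
Proof.
apply/seteqP; split=> x hx n n0.
  by apply/dual_ball_norm; rewrite subr0; exact: hx.
by move: (hx n n0) => /dual_ball_norm; rewrite subr0.
Qed.

Lemma SnE n : (0 < n)%N -> @Sn R tw n = @S0 R tw `&` dual_ball n (n * e n)%N.
Proof.
case: n => // n _; rewrite /Sn; set k := n.+1.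
have -> : (d k)%:~R / (m k)%:R - k%:R / (f k)%:R =
    (d k - (k * e k)%N%:Z)%:~R / (m k)%:R :> R.
  rewrite rmorphB /= mulrBl; congr (_ - _); rewrite tw_m_ef -pmulrn !natrM.
  by field; rewrite !pnatr_eq0 -!lt0n tw_e_gt0 tw_f_gt0.
apply/seteqP; split=> x [xS xk]; split=> //.
  by apply/dual_ball_norm.
by move: xk => /dual_ball_norm.
Qed.

(* [pairing l x] is computed from the coordinate of x at the least level containing
   l. Working only with l whose least level is n (up to the dummy index 0) makes
   it a function of x n and avoids transitivity of traces in the tower. *)
Definition exact_level n (l : K) := l \in Kn n /\ ((n <= 1)%N \/ l \notin Kn n.-1).

Lemma pairingE n l (x : Kbar tw) : (0 < n)%N -> exact_level n l ->
  pairing l x = field_trace (Kn 1) (Kn n) (l * (x n / (m n)%:R)).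
Proof.
move=> n0 [ln lev]; rewrite /pairing /tw_level; case: ex_minnP => i li imin.
have m1K : (m n)%:R^-1 \in Kn 1 by rewrite rpredV rpred_nat.
have [n1|n1] := leqP n 1.
  have {n0 n1}n1 : n = 1%N by apply/eqP; rewrite eqn_leq n1.
  subst n; have l0 : l \in Kn 0 by rewrite tw_sub0.
  have i0 : i = 0%N by apply/eqP; rewrite -leqn0; exact: imin.
  have /asboolP[_ /(_ 0%N 1%N isT) x01] := Kbar_valP x.
  rewrite i0 /tw_T ltn0 x01 /tw_T /= tw_m1 tw_m0 divr1 divr1 mul1r.
  have x1 := Kbar_in 1 x.
  rewrite !field_trace_id ?rpredM// => y; by rewrite tw_sub0.
have {}lev : l \notin Kn n.-1 by case: lev => //; rewrite leqNgt n1.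
have -> : i = n.
  apply/eqP; rewrite eqn_leq imin//= leqNgt; apply: contra lev => ilt.
  by apply: tw_sub_le li; rewrite -ltnS prednK.
rewrite /tw_T n1 tw_m1 mul1r.
rewrite -(field_traceZ (@tw_sub1 n) (tw_mP tw n)) ?rpredM ?Kbar_in//.
by congr field_trace; rewrite mulrC mulrA.
Qed.

Lemma dual_ballD n j (x y : Kbar tw) :
  dual_ball n j x -> dual_ball n j y -> dual_ball n j (x + y).
Proof.
rewrite /dual_ball /= => hx hy; rewrite mulrDl.
by rewrite (nabs_leD (absP n))// coord_in.
Qed.

Lemma dual_ball0 n j : dual_ball n j 0.
Proof.
by rewrite /dual_ball /= mul0r (nabs0 (absP n)) exprz_ge0.
Qed.

Lemma dual_ball_exists n (x : Kbar tw) (j : int) :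
  exists M : nat, dual_ball n (j - M%:Z) x.
Proof.
have q1 := nabs_base_gt1 (absP n).
have [h|/(nabs_gt_exp (absP n) (coord_in n x))[M _ xM]] :=
    leP (abs n (x n / (m n)%:R)) (Q n ^ (d n - j)).
  by exists 0%N; rewrite subr0.
exists M; rewrite /dual_ball /= xM (_ : d n - (j - M%:Z) = d n - j + M%:Z)//.
by rewrite opprB addrCA addrC.
Qed.

Lemma open_dual_ball_invariant n j (A : set (Kbar tw)) :
  (forall x y, A x -> dual_ball n j (y - x) -> A y) -> open A.
Proof.
move=> Ainv; set rho : R := nrm (m n)%:R *
  Q n `^ ((d n - j + 1)%:~R / (m n)%:R).
have Q0 := nabs_base_gt0 (absP n).
have rho0 : 0 < rho.
  rewrite mulr_gt0 ?powR_gt0// (tw_normP (rpred_nat (Kn n) _)) powR_gt0//.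
  by rewrite (nabs_gt0 (absP n)) ?rpred_nat// tw_natr_neq0 ?tw_m_gt0.
have -> : A = \bigcup_(x in A) seminorm_ball (x, n, rho).
  apply/seteqP; split=> [x Ax|y [x Ax]].
    exists x => //; rewrite /seminorm_ball /= subrr (tw_normP (rpred0 (Kn n))).
    by rewrite (nabs0 (absP n)) powR0// invr_eq0 pnatr_eq0 -lt0n tw_m_gt0.
  rewrite /seminorm_ball /= => yx; apply: Ainv Ax _.
  have zE : (y n - x n) / (m n)%:R \in Kn n by exact: (coord_in n (y - x)).
  change (is_true (abs n ((y n - x n) / (m n)%:R) <= Q n ^ (d n - j))).
  apply: (nabs_lt_le (absP n) zE).
  rewrite ltNge; apply: contraTN yx => h; rewrite -leNgt /rho.
  have mn0 : (m n)%:R != 0 :> K by rewrite tw_natr_neq0 ?tw_m_gt0.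
  have am : 0 < abs n (m n)%:R by rewrite (nabs_gt0 (absP n)) ?rpred_nat.
  have yxE : y n - x n \in Kn n by rewrite rpredB ?Kbar_in.
  rewrite (tw_normP (rpred_nat (Kn n) _)) (tw_normP yxE) powRrM powR_intmul ?(ltW Q0)//.
  rewrite -powRM ?exprz_ge0 ?(ltW Q0) ?(ltW am)//.
  rewrite ler_powR2r ?invr_gt0 ?ltr0n ?tw_m_gt0 ?(nabs_ge0 (absP n))//; last first.
    by rewrite mulr_ge0 ?exprz_ge0 ?ltW.
  move: h; rewrite (nabsM (absP n)) ?rpredV ?rpred_nat// (nabsV (absP n)) ?rpred_nat//.
  by rewrite ler_pdivlMr// mulrC.
exists [set seminorm_ball (x, n, rho) | x in A].
  move=> _ [x _ <-]; apply: finI_from1; exact: rho0.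
by rewrite bigcup_image.
Qed.

Lemma measurable_dual_ball_invariant n j (A : set (Kbar tw)) :
  (forall x y, A x -> dual_ball n j (y - x) -> A y) -> measurable A.
Proof. by move=> Ainv; apply: sub_gen_smallest; exact: open_dual_ball_invariant Ainv. Qed.

Lemma dual_ball_open n j : open (dual_ball n j).
Proof.
apply: (@open_dual_ball_invariant n j) => x y xj yxj.
by rewrite -(subrK x y); exact: dual_ballD.
Qed.

Lemma dual_ball_measurable n j : measurable (dual_ball n j).
Proof. by apply: sub_gen_smallest; exact: dual_ball_open. Qed.

Lemma S0_measurable : measurable (@S0 R tw).
Proof. rewrite S0E; apply: bigcap_measurable => [|n _]; first by exists 1%N.
exact: dual_ball_measurable.
 Qed.

End Tower.

(** * The Levy measure of dual balls *)

Section LevyMeasure.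
Variables (R : realType) (tw : local_tower R) (chi : tw -> R[i]).
Hypothesis hchi : rank_zero_character chi.
Local Notation K := (tw_field tw).
Local Notation Kn := (tw_sub tw).
Local Notation abs := (@tw_abs R tw).
Local Notation nrm := (@tw_norm R tw).
Local Notation m := (tw_m tw).
Local Notation q := (tw_q tw).
Local Notation e := (tw_e tw).
Local Notation d := (tw_d tw).
Local Notation Q n := ((q n)%:R : R).
Local Notation absP := (tw_absP tw).
Local Notation Tr n := (field_trace (Kn 1) (Kn n)).

Definition trace_char n (z : K) : R[i] := chi (Tr n z).
Local Notation phi := trace_char.

Lemma trace_charD n : {in Kn n &, {morph phi n : x y / x + y >-> x * y}}.
Proof.
move=> x y xE yE; rewrite /phi field_traceD//; last exact: tw_sub1.
by rewrite (chiD hchi) ?field_trace_sub.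
Qed.

Lemma trace_char_unitary n z : `|phi n z| = 1.
Proof. by rewrite (chi_unitary hchi) ?field_trace_sub. Qed.

Lemma trace_char_trivial n y : y \in Kn n -> abs n y <= Q n ^ d n -> phi n y = 1.
Proof.
move=> yE ay; rewrite /phi (chi_trivial hchi) ?field_trace_sub//.
exact: (tw_dP tw n).1.
Qed.

Lemma trace_char_nontrivial n y : y \in Kn n -> Q n ^ d n < abs n y ->
  exists2 c, c \in Kn n /\ abs n c <= 1 & phi n (c * y) != 1.
Proof.
move=> yE ay; have Q0 := nabs_base_gt0 (absP n).
have y0 : y != 0.
  by apply: contraTneq ay => ->; rewrite (nabs0 (absP n)) -leNgt exprz_ge0.
have [z [zE az trz]] : exists z, [/\ z \in Kn n, abs n z <= Q n ^ (d n + 1)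
    & 1 < abs 1 (Tr n z)].
  apply: contrapT => nz; have : d n + 1 <= d n.
    apply: (tw_dP tw n).2 => z zE az; rewrite leNgt; apply/negP => trz.
    by apply: nz; exists z.
  by rewrite lezD1 ltxx.
have tE := field_trace_sub (Kn 1) (Kn n) z.
set t := Tr n z in trz tE.
have t0 : t != 0.
  by apply: contraTneq trz => ->; rewrite (nabs0 (absP 1)) -leNgt ler01.
have [x0 x0E [ax0 chix0]] := chi_nontrivial hchi.
have atq : Q 1 <= abs 1 t.
  have t1 : Q 1 ^ 0 < abs 1 t by rewrite expr0z.
  have [j j0 ->] := nabs_gt_exp (absP 1) tE t1.
  by rewrite add0r -[Q 1]expr1z (ler_eXz2l (nabs_base_gt1 (absP 1))) lez_nat.
have [c [cE ac ct]] : exists c, [/\ c \in Kn 1, abs 1 c <= 1 & c * t = x0].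
  exists (x0 / t); rewrite rpred_div// divfK//; split=> //.
  rewrite (nabsM (absP 1)) ?rpredV// (nabsV (absP 1))// ler_pdivrMr ?mul1r.
    exact: le_trans ax0 atq.
  by rewrite (nabs_gt0 (absP 1)).
have zyE : z / y \in Kn n by rewrite rpred_div.
have cEn := tw_sub1 n cE.
exists (c * (z / y)).
  split; first by rewrite rpredM.
  rewrite (nabsM (absP n))// tw_abs1E//.
  rewrite mulr_ile1 ?exprn_ge0 ?exprn_ile1 ?(nabs_ge0 (absP 1)) ?(nabs_ge0 (absP n))//.
  have [j j0 ayj] := nabs_gt_exp (absP n) yE ay.
  rewrite (nabsM (absP n)) ?rpredV// (nabsV (absP n))// ler_pdivrMr ?mul1r.
    apply: le_trans az _; rewrite ayj (ler_eXz2l (nabs_base_gt1 (absP n))).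
    by rewrite lerD2l lez_nat.
  by rewrite (nabs_gt0 (absP n)).
rewrite -mulrA divfK// /phi (field_traceZ (@tw_sub1 _ _ n) (tw_mP tw n))//.
by rewrite ct.
Qed.

Definition char_defect n (l : K) (x : Kbar tw) : R :=
  1 - complex.Re (phi n (l * (x n / (m n)%:R))).
Local Notation G := char_defect.

Lemma Re_unitary_le1 (z : R[i]) : `|z| = 1 -> `|complex.Re z| <= 1.
Proof. by move=> z1; have := normc_ge_Re z; rewrite z1 -[1]/(1%:C%C) lecR. Qed.

Lemma Im_unitary_le1 (z : R[i]) : `|z| = 1 -> `|complex.Im z| <= 1.
Proof.
move=> z1; have := add_Re2_Im2 z; rewrite z1 expr1n -[1]/(1%:C%C) => /complexI h.
by rewrite -(@expr_le1 _ 2)// real_normK ?num_real// -h lerDr sqr_ge0.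
Qed.

Lemma char_defect_ge0 n l x : 0 <= G n l x.
Proof.
rewrite subr_ge0; have := Re_unitary_le1 (trace_char_unitary n (l * (x n / (m n)%:R))).
exact: le_trans (ler_norm _).
Qed.

Lemma char_defect_le2 n l x : G n l x <= 2.
Proof.
have := Re_unitary_le1 (trace_char_unitary n (l * (x n / (m n)%:R))).
by rewrite /G ler_norml => /andP[h _]; lra.
Qed.

Lemma trace_char_dual_ball n l j (x : Kbar tw) : l \in Kn n -> abs n l <= Q n ^ j ->
  dual_ball n j x -> phi n (l * (x n / (m n)%:R)) = 1.
Proof.
move=> lE al xj; apply: trace_char_trivial; first exact: rpredM (coord_in n x).
rewrite (nabsM (absP n)) ?coord_in// -(subrK j (d n)) addrC.
rewrite exprzDr ?(nabs_base_unit (absP n))//.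
by rewrite ler_pM ?(nabs_ge0 (absP n)) ?coord_in.
Qed.

Lemma char_defect_cong n l l' j x : l \in Kn n -> l' \in Kn n ->
  abs n (l' - l) <= Q n ^ j -> dual_ball n j x -> G n l' x = G n l x.
Proof.
move=> lE l'E al xj; rewrite /G -{1}(subrK l l') mulrDl trace_charD.
- by rewrite (trace_char_dual_ball _ al) ?mul1r ?rpredB.
- exact: rpredM (rpredB l'E lE) (coord_in n x).
- exact: rpredM (coord_in n x).
Qed.

Lemma tw_abs_bound n l : l \in Kn n -> exists j, abs n l <= Q n ^ j.
Proof.
move=> lE; have [->|l0] := eqVneq l 0.
  by exists 0; rewrite (nabs0 (absP n)) ler01.
by have [z ->] := nabs_value (absP n) lE l0; exists z.
Qed.

Lemma trace_char_measurable n l (h : R[i] -> R) : l \in Kn n ->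
  measurable_fun setT (fun x : Kbar tw => h (phi n (l * (x n / (m n)%:R)))).
Proof.
move=> lE; have [j al] := tw_abs_bound lE => _ Y mY; rewrite setTI.
apply: (@measurable_dual_ball_invariant _ _ n j) => x y; rewrite /preimage /=.
move=> + yx; suff -> : phi n (l * (y n / (m n)%:R)) = phi n (l * (x n / (m n)%:R)) by [].
have -> : y n / (m n)%:R = (y - x) n / (m n)%:R + x n / (m n)%:R.
  by rewrite -mulrDl; congr (_ / _); rewrite /= subrK.
rewrite mulrDr trace_charD ?(rpredM lE (coord_in n _))//.
by rewrite (trace_char_dual_ball lE al yx) mul1r.
Qed.

Lemma char_defect_measurable n l : l \in Kn n -> measurable_fun setT (G n l).
Proof. by move=> lE; exact: (trace_char_measurable (fun z => 1 - complex.Re z)). Qed.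

Lemma exact_level_approx n l j : (0 < n)%N -> l \in Kn n ->
  exists2 l', exact_level n l' & abs n (l' - l) <= Q n ^ j.
Proof.
move=> n0 lE; have [n1|n1] := leqP n 1.
  by exists l; [split=> //; left|rewrite subrr (nabs0 (absP n)) exprz_ge0].
have [lE'|lnE'] := boolP (l \in Kn n.-1); last first.
  by exists l; [split=> //; right|rewrite subrr (nabs0 (absP n)) exprz_ge0].
have n10 : (0 < n.-1)%N by lia.
have [_ [x xE xnE]] := tw_subS tw n10; rewrite prednK// in xE.
have x0 : x != 0 by apply: contraNneq xnE => ->; exact: rpred0.
have [w ax] := nabs_value (absP n) xE x0.
have [c [cE c0 ac]] := nabs_exists (absP 1) (- `|w - j|%N%:Z).
exists (l + c * x).
  split; first by rewrite rpredD ?rpredM// tw_sub1.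
  right; apply: contra xnE => lcx.
  have -> : x = c^-1 * (l + c * x - l) by rewrite addrC addKr mulKf.
  by apply: rpredM; [rewrite rpredV tw_sub1|exact: rpredB].
have cEn := tw_sub1 n cE.
rewrite addrC addKr (nabsM (absP n))// tw_abs1E// ac ax.
have -> : (Q 1 ^ (- `|w - j|%N%:Z)) ^+ m n = Q n ^ (- (e n * `|w - j|)%N%:Z).
  rewrite -!invr_expz exprVn; congr (_^-1).
  by rewrite -!exprnP -exprM mulnC exprM -natrX -tw_q_ramified natrX -exprM.
rewrite -exprzDr ?(nabs_base_unit (absP n))// (ler_eXz2l (nabs_base_gt1 (absP n))).
have : (`|w - j| <= e n * `|w - j|)%N by rewrite leq_pmull ?tw_e_gt0.
lia.
Qed.

Variables (alpha : R) (p : R -> probability (Kbar tw) R).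
Hypothesis hp : stable_semigroup alpha chi p.
Variables (d0 : measure_display) (Om : measurableType d0) (P : probability Om R).
Variables (X : R -> Om -> Kbar tw) (hX : levy_process P X).
Hypothesis hXp : forall t : R, 0 < t -> forall A : set (Kbar tw), measurable A ->
  P (X t @^-1` A) = p t A.
Variables (Pi : {measure set (Kbar tw) -> \bar R}) (hPi : levy_measure chi P X Pi).

(* The Levy exponent of the process: ||l||^alpha if ||l|| > 1, and 0 otherwise. *)
Definition symbol n (l : K) : R :=
  if abs n l <= 1 then 0 else abs n l `^ (alpha / (m n)%:R).

Lemma tw_norm_le1 n l : l \in Kn n -> (nrm l <= 1) = (abs n l <= 1).
Proof.
move=> lE; rewrite (tw_normP lE).
transitivity (abs n l `^ (m n)%:R^-1 <= 1 `^ (m n)%:R^-1); first by rewrite powR1.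
by rewrite ler_powR2r ?invr_gt0 ?ltr0n ?tw_m_gt0 ?(nabs_ge0 (absP n)).
Qed.

Lemma Cintegral_char n l (t : R) : 0 < t -> (0 < n)%N -> exact_level n l ->
  Cintegral P (fun w => chi (pairing l (X t w))) = (expR (- t * symbol n l))%:C%C.
Proof.
move=> t0 n0 ll; have lE := ll.1.
have mX : measurable_fun setT (X t) := levy_measurable hX (ltW t0).
have E (h : R[i] -> R) : (forall z, `|z| = 1 -> `|h z| <= 1) ->
    Rintegral P setT (fun w => h (chi (pairing l (X t w)))) =
    Rintegral (p t) setT (fun x => h (chi (pairing l x))).
  move=> h1.
  have eqp x : h (chi (pairing l x)) = h (phi n (l * (x n / (m n)%:R))).
    by rewrite (pairingE _ n0 ll).
  have mh : measurable_fun setT (fun x : Kbar tw => h (chi (pairing l x))).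
    by under eq_fun do rewrite eqp; exact: trace_char_measurable.
  rewrite /Rintegral; congr fine.
  transitivity (\int[pushforward P (X t)]_x (h (chi (pairing l x)))%:E)%E; last first.
    by apply: eq_measure_integral => A mA _; exact: hXp.
  rewrite integral_pushforward//.
  - exact/measurable_EFinP.
  - rewrite preimage_setT; apply: measurable_bounded_integrable => //.
    + by rewrite -ge0_fin_numE // fin_num_measure.
    + exact: measurableT_comp mh mX.
    + exists 1; split=> // M M1 w _ /=; apply: le_trans (ltW M1).
      by rewrite eqp h1// trace_char_unitary.
rewrite /Cintegral !E ?/(Cintegral _ _); last 2 first.
- exact: Im_unitary_le1.
- exact: Re_unitary_le1.
rewrite -/(Cintegral (p t) (fun x => chi (pairing l x))) /symbol -tw_norm_le1//.
case: leP => [l1|l1]; first by rewrite (sg_fourier0 hp)// mulr0 expR0.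
rewrite -(mulrC (m n)%:R^-1) powRrM -(tw_normP lE).
exact: (sg_fourier1 hp t0 l1).
Qed.

(* Needed because [Rintegral] has the junk value 0 when the integral is infinite. *)
Lemma integral_char_defect_lty n l : l \in Kn n ->
  (\int[Pi]_x (G n l x)%:E < +oo)%E.
Proof.
move=> lE; have [j al] := tw_abs_bound lE.
have G0 x : dual_ball n j x -> G n l x = 0.
  by move=> xj; rewrite /G (trace_char_dual_ball lE al xj) subrr.
have mD : measurable (~` dual_ball n j : set (Kbar tw)).
  by apply: measurableC; exact: dual_ball_measurable.
have PiD : (Pi (~` dual_ball n j) < +oo)%E.
  by apply: (lm_finite hPi); [exact: dual_ball_open|exact: dual_ball0].
apply: (@le_lt_trans _ _ (\int[Pi]_x (2 * \1_(~` dual_ball n j) x)%:E)%E).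
  apply: ge0_le_integral => //.
  - by move=> x _; rewrite lee_fin char_defect_ge0.
  - by apply/measurable_EFinP; exact: char_defect_measurable.
  - by apply/measurable_EFinP; apply: measurable_funM => //; exact: measurable_indic.
  - move=> x _; rewrite lee_fin indicE in_setC; case: (boolP (_ \in _)) => /=.
      by rewrite inE => /G0 ->; rewrite mulr0.
    by rewrite mulr1 char_defect_le2.
rewrite (integralZl_indic _ (fun=> ~` dual_ball n j))//; last first.
  by rewrite ltNge ler0n.
by rewrite integral_indic// setIT lte_mul_pinfty.
Qed.

Lemma integral_char_defect_exact n l : (0 < n)%N -> exact_level n l ->
  (\int[Pi]_x (G n l x)%:E)%E = (symbol n l)%:E.
Proof.
move=> n0 ll; have lE := ll.1.
have Gfin : (\int[Pi]_x (G n l x)%:E)%E \is a fin_num.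
  rewrite ge0_fin_numE ?integral_char_defect_lty//.
  by apply: integral_ge0 => x _; rewrite lee_fin char_defect_ge0.
have := lm_exponent hPi l ltr01; rewrite (Cintegral_char ltr01 n0 ll).
rewrite {1}/Cintegral mul1r; set b := Rintegral _ _ _; set c := Rintegral _ _ _.
case=> hc hs.
have aE : b = - fine (\int[Pi]_x (G n l x)%:E).
  rewrite /b /Rintegral -fineN -integral_ge0N => [|x _]; last first.
    by rewrite lee_fin char_defect_ge0.
  congr fine; apply: eq_integral => x _.
  rewrite (pairingE _ n0 ll) /G /phi -EFinN opprB; congr _%:E.
  by case: (chi _).
rewrite -(fineK Gfin) -[fine _]opprK -aE; congr _%:E.
suff -> : b = - symbol n l by rewrite opprK.
apply: expR_inj; apply: (@pexpIrn _ 2) => //; rewrite ?nnegrE ?expR_ge0//.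
have := cos2Dsin2 c => h1.
rewrite -[LHS]mulr1 -h1 mulrDr -!exprMn -hs expr0n addr0 /=.
by rewrite -[symbol n l]mul1r -mulNr hc.
Qed.

Lemma integral_sum_char_defect n (s : seq K) : {subset s <= Kn n} ->
  (\int[Pi]_x (\sum_(l <- s) G n l x)%:E = \sum_(l <- s) \int[Pi]_x (G n l x)%:E)%E.
Proof.
move=> sE; pose F l x := if l \in s then (G n l x)%:E else 0%E.
transitivity (\int[Pi]_x \sum_(l <- s) F l x)%E.
  apply: eq_integral => x _; rewrite -sumEFin; apply: eq_big_seq => l ls.
  by rewrite /F ls.
rewrite ge0_integral_sum//.
- apply: eq_big_seq => l ls; apply: eq_integral => x _; by rewrite /F ls.
- move=> l; rewrite /F; case: (boolP (l \in s)) => // ls.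
  by apply/measurable_EFinP; apply: char_defect_measurable; exact: sE.
- by move=> l x _; rewrite /F; case: ifP => // _; rewrite lee_fin char_defect_ge0.
Qed.

Lemma levy_char_sum n (s : seq K) (A B : set (Kbar tw)) (c : R) :
  {subset s <= Kn n} -> measurable A -> measurable B -> 0 <= c ->
  (forall x, A x -> \sum_(l <- s) G n l x = c * \1_B x) ->
  (c%:E * Pi (B `&` A) <= \sum_(l <- s) \int[Pi]_x (G n l x)%:E)%E /\
  (Pi (~` A) = 0 -> c%:E * Pi (B `&` A) = \sum_(l <- s) \int[Pi]_x (G n l x)%:E)%E.
Proof.
move=> sE mA mB c0 sG; rewrite -integral_sum_char_defect//.
have mS : measurable_fun setT (fun x => (\sum_(l <- s) G n l x)%:E).
  apply/measurable_EFinP; under eq_fun do rewrite big_seq big_mkcond.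
  apply: measurable_sum => l; case: (boolP (l \in s)) => // ls.
  by apply: char_defect_measurable; exact: sE.
have S0 x : setT x -> (0 <= (\sum_(l <- s) G n l x)%:E)%E.
  by move=> _; rewrite lee_fin sumr_ge0// => l _; exact: char_defect_ge0.
have -> : (c%:E * Pi (B `&` A) = \int[Pi]_(x in A) (\sum_(l <- s) G n l x)%:E)%E.
  rewrite (eq_integral (fun x => (c * \1_B x)%:E)) => [|x]; last first.
    by rewrite inE => /sG ->.
  rewrite (integralZl_indic _ (fun=> B))//; last by rewrite ltNge c0.
  by rewrite integral_indic.
split; first exact: ge0_subset_integral.
move=> A0; rewrite [RHS](ge0_negligible_integral (N := ~` A))//.
  by rewrite setTD setCK.
exact: measurableC.
Qed.

Lemma exact_level_perturb n j : (0 < n)%N -> exists g : K -> K,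
  {in Kn n, forall l, exact_level n (g l) /\ abs n (g l - l) <= Q n ^ j}.
Proof.
move=> n0.
have /choice[g hg] : forall l, exists l', l \in Kn n ->
    exact_level n l' /\ abs n (l' - l) <= Q n ^ j.
  move=> l; have [lE|lnE] := boolP (l \in Kn n); last by exists 0.
  by have [l' ? ?] := exact_level_approx j n0 lE; exists l'.
by exists g => l /hg.
Qed.

Lemma complex_Re_sum (I : Type) (s : seq I) (F : I -> R[i]) :
  complex.Re (\sum_(i <- s) F i) = \sum_(i <- s) complex.Re (F i).
Proof. by elim/big_rec2: _ => // i y1 y2 _ <-; case: (F i) y2 => ? ? []. Qed.

Lemma complex_Re_nat k : complex.Re (k%:R : R[i]) = k%:R.
Proof. by rewrite -(rmorph_nat (real_complex R)). Qed.

Lemma sum_char_defect n (s : seq K) x : \sum_(l <- s) G n l x =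
  (size s)%:R - complex.Re (\sum_(l <- s) phi n (l * (x n / (m n)%:R))).
Proof.
by rewrite complex_Re_sum sumrB big_const_seq count_predT iter_addr_0.
Qed.

Lemma levy_dual_shell n (M : nat) : (0 < n)%N ->
  Pi (dual_ball n (- M.+1%:Z) `\` dual_ball n (- M%:Z)) = 0%E.
Proof.
move=> n0; have [r [i0 [hr _ _]]] := residue_system0 (absP n).
have [w [wE w0 aw]] := nabs_exists (absP n) (- M%:Z).
have [g hg] := exact_level_perturb (- M.+1%:Z) n0.
have rE i : r i * w \in Kn n by rewrite rpredM//; case: hr => /(_ i)[].
set A := _ `\` _; have mA : measurable A.
  by apply: measurableD; exact: dual_ball_measurable.
pose s := [seq g (r i * w) | i <- enum 'I_(q n)].
have sE : {subset s <= Kn n}.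
  by move=> _ /mapP[i _ ->]; have [[]] := hg _ (rE i).
have [|x Ax|le _] := @levy_char_sum n s A A (q n)%:R sE mA mA.
- exact: ler0n.
- rewrite indicE mem_set// mulr1 big_map.
  under eq_bigr => i _ do
    rewrite (char_defect_cong (rE i) (hg _ (rE i)).1.1 (hg _ (rE i)).2 Ax.1).
  rewrite -(big_map (fun i => r i * w) xpredT (fun l => G n l x)) sum_char_defect.
  rewrite size_map size_enum_ord big_map big_enum /=.
  have [xE [xM /negP]] := (coord_in n x, Ax).
  rewrite -ltNge => /(nabs_gt_exp (absP n) xE)[j j0 xj].
  have j1 : j = 1%N.
    apply/eqP; rewrite eqn_leq j0 andbT; move: xM; rewrite /dual_ball /= xj.
    by rewrite (ler_eXz2l (nabs_base_gt1 (absP n))); lia.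
  have zE : w * (x n / (m n)%:R) \in Kn n by exact: rpredM.
  have az : abs n (w * (x n / (m n)%:R)) = Q n ^ (d n + 1).
    rewrite (nabsM (absP n))// aw xj -exprzDr ?(nabs_base_unit (absP n))//.
    by congr (_ ^ _); rewrite j1; lia.
  under eq_bigr => i _ do rewrite -mulrA.
  rewrite (sum_residue_nontrivial (absP n) hr (@trace_charD n)
    (@trace_char_trivial n) (@trace_char_nontrivial n) zE az).
  by rewrite subr0.
move: le; rewrite setIid big_map big1 => [|i _]; last first.
  have [gl gd] := hg _ (rE i); rewrite integral_char_defect_exact// /symbol.
  suff -> : abs n (g (r i * w)) <= 1 by [].
  have le1 (k : nat) : Q n ^ (- k%:Z) <= 1.
    by rewrite -[leRHS](expr0z (Q n)) (ler_eXz2l (nabs_base_gt1 (absP n))); lia.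
  rewrite -(subrK (r i * w) (g _)); apply: (nabs_leD (absP n)).
  - by rewrite rpredB// gl.1.
  - exact: rE.
  - exact: le_trans gd (le1 _).
  case: hr => /(_ i)[riE ri1] _ _.
  by rewrite (nabsM (absP n))// mulr_ile1 ?(nabs_ge0 (absP n))// aw.
rewrite pmule_rle0 ?lte_fin ?(nabs_base_gt0 (absP n))// => A0.
by apply/eqP; rewrite eq_le A0 measure_ge0.
Qed.

Lemma levy_dual_ball0 n : (0 < n)%N -> Pi (~` dual_ball n 0) = 0%E.
Proof.
move=> n0.
have -> : ~` (dual_ball n 0 : set (Kbar tw)) =
    \bigcup_M (dual_ball n (- M.+1%:Z) `\` dual_ball n (- M%:Z)).
  apply/seteqP; split=> [x x0|x [M _ [_ xM]]]; last first.
    by apply: contra_not xM; apply: dual_ball_le; lia.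
  have [M] := dual_ball_exists n x 0; rewrite sub0r.
  elim: M => [|M IH] xM; first by rewrite oppr0 in xM.
  have [xM'|xM'] := pselect (dual_ball n (- M%:Z) x); first exact: IH.
  by exists M.
have mshell M : measurable (dual_ball n (- M.+1%:Z) `\` dual_ball n (- M%:Z) : set (Kbar tw)).
  by apply: measurableD; exact: dual_ball_measurable.
apply/negligibleP; first exact: bigcupT_measurable.
by apply: negligible_bigcup => M; apply/negligibleP => //; exact: levy_dual_shell.
Qed.

Lemma integral_char_defect n l : (0 < n)%N -> l \in Kn n ->
  (\int[Pi]_x (G n l x)%:E)%E = (symbol n l)%:E.
Proof.
move=> n0 lE; have [l' l'l al] := exact_level_approx 0 n0 lE.
have -> : symbol n l = symbol n l'.
  rewrite expr0z in al; rewrite /symbol -(subrK l l').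
  have l'lE : l' - l \in Kn n by rewrite rpredB// l'l.1.
  case: (leP (abs n l) 1) => l1; first by rewrite (nabs_leD (absP n)).
  by rewrite (nabs_dominant (absP n))// ?(le_lt_trans al)// leNgt l1.
rewrite -integral_char_defect_exact//.
have mG k : k \in Kn n -> measurable_fun setT (fun x => (G n k x)%:E).
  by move=> kE; apply/measurable_EFinP; exact: char_defect_measurable.
have G0 k x : setT x -> (0 <= (G n k x)%:E)%E.
  by move=> _; rewrite lee_fin char_defect_ge0.
have mD : measurable (~` dual_ball n 0 : set (Kbar tw)).
  by apply: measurableC; exact: dual_ball_measurable.
have l'E := l'l.1.
rewrite (ge0_negligible_integral mD _ (mG l lE) (G0 l) (levy_dual_ball0 n0))//.
rewrite [RHS](ge0_negligible_integral mD _ (mG l' l'E) (G0 l') (levy_dual_ball0 n0))//.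
apply: eq_integral => x; rewrite inE setTD setCK => x0.
by rewrite (char_defect_cong lE l'E al x0).
Qed.

Lemma levy_dual_ballC n (N : nat) : (0 < n)%N ->
  ((Q n ^+ N)%:E * Pi (~` dual_ball n N) =
   (\sum_(l < N) (Q n - 1) * Q n ^+ l * (Q n ^+ l.+1) `^ (alpha / (m n)%:R))%:E)%E.
Proof.
move=> n0; have [r [i0 [hr ri0 ri1]]] := residue_system0 (absP n).
have [w wE aw] := nabs_uniformizer (absP n).
have sE x : x \in digits r w N -> x \in Kn n.
  by move=> xs; have [] := digitsP (absP n) hr wE aw xs.
have mB : measurable (~` dual_ball n N : set (Kbar tw)).
  by apply: measurableC; exact: dual_ball_measurable.
have [|x Ax|_] := @levy_char_sum n _ (dual_ball n 0) _ (Q n ^+ N) sE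
  (dual_ball_measurable _ _) mB.
- by rewrite exprn_ge0 ?ler0n.
- rewrite sum_char_defect size_digits.
  rewrite (sum_digits_char (absP n) hr (@trace_charD n)
    (@trace_char_trivial n) (@trace_char_nontrivial n) wE aw N (coord_in n x)); last first.
    by move: Ax; rewrite /dual_ball /= subr0.
  rewrite indicE in_setC; case: ifPn => h.
    by rewrite mem_set// mulr0 complex_Re_nat subrr.
  by rewrite memNset//=; [rewrite subr0 mulr1 natrX|apply/negP].
move=> /(_ (levy_dual_ball0 n0)).
have -> : Pi (~` dual_ball n N `&` dual_ball n 0) = Pi (~` dual_ball n N).
  rewrite [RHS](measureDI _ mB (dual_ball_measurable n 0)) [X in (X + _)%E](_ : _ = 0%E).
    by rewrite add0e.
  apply: (@subset_measure0 _ _ _ _ _ (~` dual_ball n 0)); last exact: levy_dual_ball0.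
  - by apply: measurableD => //; exact: dual_ball_measurable.
  - by apply: measurableC; exact: dual_ball_measurable.
  - by move=> x [].
move=> ->.
rewrite -(sum_digits_norm (absP n) hr wE aw ri0 ri1 (fun u => u `^ (alpha / (m n)%:R))).
rewrite -sumEFin; apply: eq_big_seq => l ls.
by rewrite integral_char_defect ?sE.
Qed.

End LevyMeasure.

(** * The measure of S \ S_n *)

Lemma null_S0C (R : realType) (tw : local_tower R) (Pi : {measure set (Kbar tw) -> \bar R}) :
  (forall n, (0 < n)%N -> Pi (~` dual_ball n 0) = 0%E) -> Pi (~` @S0 R tw) = 0%E.
Proof.
move=> PiD.
have mD n : measurable (~` dual_ball n 0 : set (Kbar tw)).
  by apply: measurableC; exact: dual_ball_measurable.
have -> : ~` @S0 R tw = \bigcup_n ~` dual_ball n.+1 0.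
  rewrite S0E setC_bigcap; apply/seteqP; split=> x [n].
    by case: n => // n _ nx; exists n.
  by move=> _ nx; exists n.+1.
apply/negligibleP; first exact: bigcupT_measurable.
by apply: negligible_bigcup => n; apply/negligibleP => //; exact: PiD.
Qed.

Lemma sum_powR_geometric (R : realType) (x a : R) N : 1 < x -> 0 < a ->
  \sum_(l < N) (x - 1) * x ^+ l * (x ^+ l.+1) `^ a =
  (1 - x^-1) * ((x `^ ((N + 1)%:R * (a + 1)) - x `^ (a + 1)) / (x `^ (a + 1) - 1)).
Proof.
move=> x1 a0; have x0 : 0 < x by exact: lt_trans x1.
set u := x `^ (a + 1).
have uE : u = x `^ a * x by rewrite /u powRD ?powRr1 ?(ltW x0)// (gt_eqF x0) implybT.
have xa1 : 1 <= x `^ a by rewrite -[1](powRr0 x) ler_powR ?ltW.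
have u1 : 1 < u by rewrite uE; apply: lt_le_trans x1 _; rewrite ler_peMl ?(ltW x0).
have -> : x `^ ((N + 1)%:R * (a + 1)) = u ^+ N * u.
  by rewrite mulrC powRrM powR_mulrn ?powR_ge0// addn1 exprSr.
have -> : \sum_(l < N) (x - 1) * x ^+ l * (x ^+ l.+1) `^ a =
    (1 - x^-1) * u * \sum_(l < N) u ^+ l.
  rewrite mulr_sumr; apply: eq_bigr => l _.
  have -> : (x ^+ l.+1) `^ a = (x `^ a) ^+ l.+1.
    by rewrite -(powR_mulrn l.+1 (ltW x0)) powRAC powR_mulrn ?powR_ge0.
  rewrite uE exprMn [in LHS]exprSr; field.
  by rewrite gt_eqF.
have un0 : u - 1 != 0 by rewrite subr_eq0 gt_eqF.
have -> : \sum_(l < N) u ^+ l = (u ^+ N - 1) / (u - 1).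
  by rewrite subrX1 mulrC mulKf.
by field; rewrite un0 gt_eqF.
Qed.

Lemma levy_ratio_bounds (R : realType) (x a u : R) (n N : nat) : 2 <= x -> 0 < a ->
  (0 < n <= N)%N -> u = x `^ (a + 1) ->
  1 - (2 * a + n%:R^-1) <= (1 - x^-1) * (u / (u - 1)) * (1 - u ^- N) <= 1.
Proof.
move=> x2 a0 nN uxa; set v := _ * (1 - _); have x0 : 0 < x by lra.
have xV : 0 < x^-1 by rewrite invr_gt0.
have xa1 : 1 <= x `^ a.
  by rewrite -[1](powRr0 x) ler_powR ?(ltW a0)//; lra.
have uE : u = x `^ a * x by rewrite uxa powRD ?powRr1 ?(ltW x0)// (gt_eqF x0) implybT.
have u0 : 0 < u by rewrite uE mulr_gt0// powR_gt0.
set s := x^-1 in xV v *; have s2 : s <= 2^-1 by rewrite lef_pV2 ?posrE.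
pose c := (x `^ a)^-1; have c0 : 0 < c by rewrite invr_gt0 powR_gt0.
have c1 : c <= 1 by rewrite invf_le1 ?powR_gt0.
have lnx : ln x <= x.
  rewrite -ler_expR lnK ?posrE//; apply: le_trans (expR_ge1Dx x).
  by rewrite lerDr.
have ca : 1 - a * x <= c.
  apply: (@le_trans _ _ (1 + - (a * ln x))).
    by rewrite lerD2l lerN2 ler_pM2l.
  rewrite /c /powR (gt_eqF x0) -expRN; exact: expR_ge1Dx.
pose w := s * c; have uw : u^-1 = w by rewrite uE invfM mulrC.
have w0 : 0 < w by rewrite mulr_gt0.
have ws : w <= s by rewrite /w ler_piMr// ltW.
have sx : s * x = 1 by rewrite /s mulVf// gt_eqF.
have wa : s - a <= w.
  have : s * (1 - a * x) <= s * c by rewrite ler_pM2l.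
  by rewrite mulrBr mulr1 mulrCA sx mulr1.
pose t := w ^+ N; have t0 : 0 <= t by rewrite exprn_ge0// ltW.
have tn : t <= n%:R^-1.
  have /andP[n0 leN] := nN.
  apply: (@le_trans _ _ (2^-1 ^+ N)).
    by apply: lerXn2r; rewrite ?nnegrE ?invr_ge0 ?(ltW w0) ?(le_trans ws s2).
  rewrite exprVn lef_pV2 ?posrE ?exprn_gt0 ?ltr0n// -natrX ler_nat.
  by apply: leq_trans leN _; apply: ltnW; apply: ltn_expl.
have u1 : u - 1 != 0.
  rewrite subr_eq0 gt_eqF// -invf_lt1// uw; lra.
pose A := (1 - s) / (1 - w).
have vE : v = A * (1 - t).
  rewrite /v /A /t -uw exprVn; congr (_ * _); congr (_ * _).
  by field; rewrite u1 gt_eqF.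
have w1 : 0 < 1 - w by lra.
have A1 : A <= 1 by rewrite ler_pdivrMr//; lra.
have A0 : 0 <= A by rewrite divr_ge0//; lra.
have Aa : 1 - 2 * a <= A by rewrite ler_pdivlMr//; nra.
have At : A * t <= t by rewrite ler_piMl.
have At0 : 0 <= A * t by rewrite mulr_ge0.
by rewrite vE mulrBr mulr1; apply/andP; split; lra.
Qed.

Theorem theorem1 (R : realType) (tw : local_tower R) (alpha : R)
    (halpha : 0 < alpha)
    (chi : tw -> R[i]) (hchi : rank_zero_character chi)
    (p : R -> probability (Kbar tw) R) (hp : stable_semigroup alpha chi p)
    (d : measure_display) (Om : measurableType d) (P : probability Om R)
    (X : R -> Om -> Kbar tw) (hX : levy_process P X)
    (hXp : forall t : R, 0 < t -> forall A : set (Kbar tw), measurable A ->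
       P (X t @^-1` A) = p t A)
    (Pi : {measure set (Kbar tw) -> \bar R}) (hPi : levy_measure chi P X Pi) :
  (forall n : nat, (0 < n)%N ->
     let q := (tw_q tw n)%:R : R in
     let e := tw_e tw n in
     let b := alpha / (tw_m tw n)%:R + 1 in
     Pi (@S0 R tw `\` @Sn R tw n) =
     ((1 - q^-1) * q ^- (n * e) *
      ((q `^ ((n * e + 1)%:R * b) - q `^ b) / (q `^ b - 1)))%:E) /\
  (fun n : nat => fine (Pi (@S0 R tw `\` @Sn R tw n)) /
                  (tw_q tw 1)%:R `^ (alpha * n%:R)) @ \oo --> (1 : R).
Proof.
set PiSn := (X in X /\ _); have hPiSn : PiSn.
  move=> n n0 q e b.
  have PiD k : (0 < k)%N -> Pi (~` dual_ball k 0) = 0%E.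
    exact: (levy_dual_ball0 hchi hp hX hXp hPi).
  have q1 : 1 < q := nabs_base_gt1 (tw_absP tw n).
  have qN : 0 < q ^+ (n * e) by rewrite exprn_gt0// (lt_trans _ q1).
  have mD j : measurable (~` dual_ball n j : set (Kbar tw)).
    by apply: measurableC; exact: dual_ball_measurable.
  have -> : Pi (@S0 R tw `\` @Sn R tw n) = Pi (~` dual_ball n (n * e)%N).
    rewrite [RHS](measureDI _ (mD _) (@S0_measurable R tw)) [X in (X + _)%E](_ : _ = 0%E).
      by rewrite add0e SnE// setDIr setDv set0U setDE setIC.
    apply: (@subset_measure0 _ _ _ _ _ (~` @S0 R tw)); last exact: null_S0C PiD.
    - by apply: measurableD => //; exact: S0_measurable.
    - by apply: measurableC; exact: S0_measurable.
    - by move=> x [].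
  have := levy_dual_ballC hchi hp hX hXp hPi (n * e) n0.
  rewrite sum_powR_geometric ?divr_gt0 ?ltr0n ?tw_m_gt0// => eqPi.
  rewrite -[LHS]mul1e -[1%E]/(1%:E) -[X in X%:E](mulVf (lt0r_neq0 qN)) EFinM -muleA eqPi.
  by rewrite -EFinM; congr _%:E; rewrite /b /q; ring.
split=> //; apply/cvgrPdist_le => /= eps eps0.
near=> n.
have n0 : (0 < n)%N by near: n; exists 1%N.
have n_ge : (2 * alpha + 1) / eps <= n%:R by near: n; exact: nbhs_infty_ger.
rewrite (hPiSn n n0) /=.
set x := (tw_q tw n)%:R; set m := tw_m tw n; set e := tw_e tw n.
set a := alpha / m%:R; set z := _ `^ (alpha * n%:R).
have m0 : (0 < m)%N := tw_m_gt0 tw n.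
have mR : 0 < m%:R :> R by rewrite ltr0n.
have x2 : 2 <= x by rewrite ler_nat (nabs_card_gt1 (tw_absP tw n)).
have x0 : 0 < x by apply: lt_le_trans x2.
have a0 : 0 < a by rewrite divr_gt0.
have q0 : 0 < (tw_q tw 1)%:R :> R := nabs_base_gt0 (tw_absP tw 1).
have z0 : 0 < z by rewrite powR_gt0.
have zE : z = (x `^ a) ^+ (n * e).
  rewrite -(powR_mulrn _ (powR_ge0 _ _)) -powRrM.
  have -> : a * (n * e)%:R = e%:R * (a * n%:R) by rewrite natrM; ring.
  rewrite powRrM powR_mulrn ?(ltW x0)// /x -natrX tw_q_ramified natrX.
  rewrite -powR_mulrn ?(ltW q0)// -powRrM; congr (_ `^ _).
  by rewrite /a; field; rewrite gt_eqF.
have xa1 : x `^ (a + 1) = x `^ a * x.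
  by rewrite powRD ?powRr1 ?(ltW x0)// (gt_eqF x0) implybT.
set u := x `^ (a + 1) in xa1 *.
have u0 : 0 < u by rewrite powR_gt0.
have u1 : u - 1 != 0.
  rewrite subr_eq0 gt_eqF// xa1; apply: (@lt_le_trans _ _ x).
    by apply: lt_le_trans x2; rewrite ltr1n.
  by rewrite ler_peMl ?(ltW x0)// -[1](powRr0 x) ler_powR ?(ltW a0)// (le_trans _ x2)// ler1n.
have -> : x `^ ((n * e + 1)%:R * (a + 1)) = u ^+ (n * e) * u.
  by rewrite mulrC powRrM powR_mulrn ?powR_ge0// addn1 exprSr.
have uN : u ^+ (n * e) = z * x ^+ (n * e) by rewrite xa1 exprMn zE.
have -> : (1 - x^-1) / x ^+ (n * e) * ((u ^+ (n * e) * u - u) / (u - 1)) / z =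
    (1 - x^-1) * (u / (u - 1)) * (1 - u ^- (n * e)).
  rewrite uN; field.
  by rewrite u1 !gt_eqF ?exprn_gt0.
have nne : (0 < n <= n * e)%N by rewrite n0 leq_pmulr ?tw_e_gt0.
have /andP[lo hi] := levy_ratio_bounds x2 a0 nne (erefl u).
rewrite ger0_norm ?subr_ge0//.
apply: (@le_trans _ _ (2 * a + n%:R^-1)); first lra.
have nR : 0 < n%:R :> R by rewrite ltr0n.
have an : a <= alpha / n%:R.
  by rewrite ler_pM2l// lef_pV2 ?posrE// ler_nat tw_m_ge.
apply: (@le_trans _ _ ((2 * alpha + 1) / n%:R)).
  by rewrite [leRHS]mulrDl mul1r lerD2r -mulrA ler_pM2l.
by rewrite ler_pdivrMr// [eps * _]mulrC -ler_pdivrMr.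
Unshelve. all: by end_near.
Qed.
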